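(* Let $\delta\ge 0$ and $\lambda\ge0$, and consider the nonlinear Markov process $\{X(t)\}_{t\ge0}$ on $\mathbb{N}$ which, at time $t$, with $\mu_t=\mathrm{Law}(X(t))$, has the transitions $$X(t)\to X(t)+1 \ \text{ at rate } 1+\delta,\qquad X(t)\to X(t)-1 \ \text{ at rate } 1+\lambda\,\mu_t[0,X(t)) \ \text{ if } X(t)>0,$$ and only the rightward jump if $X(t)=0$. (i) If $\lambda>4\delta$, this nonlinear process has at least one stationary distribution. (ii) If $\lambda\le 2\delta$, this nonlinear process has no stationary distribution.
   Context: $\mathbb{N}=\{0,1,2,\dots\}$, and for a probability measure $\mu$ on $\mathbb{N}$ and $x\in\mathbb{N}$, $\mu[0,x)=\sum_{y=0}^{x-1}\mu(y)$, with $\mu[0,0)=0$. A stationary distribution of the nonlinear process is a probability measure $\mu$ on $\mathbb{N}$ such that if $X(0)$ has law $\mu$ then $X(t)$ has law $\mu$ for all $t\ge0$. Equivalently, $\mu$ is a stationary distribution of the (linear) birth-and-death process on $\mathbb{N}$ with generator $$\mathcal{L}^{\mu}f(x)=(1+\delta)\big(f(x+1)-f(x)\big)+\mathbf 1(x>0)\big(1+\lambda\mu[0,x)\big)\big(f(x-1)-f(x)\big),$$ in which the measure $\mu$ is kept fixed in the rates. *)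

(* Defs.v *)
From HB Require Import structures.
From mathcomp Require Import all_boot all_order all_algebra.
From mathcomp Require Import all_classical all_reals all_analysis.
Set Implicit Arguments.
Unset Strict Implicit.
Unset Printing Implicit Defensive.
Import Order.TTheory GRing.Theory Num.Theory.
Import numFieldNormedType.Exports.
Local Open Scope classical_set_scope.
Local Open Scope ring_scope.

(* For x = 0 the set `I_0 of naturals below 0 is empty, and the value of
   x.-1 is irrelevant because of the factor (0 < x)%N%:R. *)
Definition generator (R : realType) (delta lambda : R)
    (mu : probability nat R) (f : nat -> R) (x : nat) : R :=
  (1 + delta) * (f x.+1 - f x)
  + (0 < x)%N%:R * (1 + lambda * fine (mu `I_x)) * (f x.-1 - f x).

(* A (time-inhomogeneous) Markov process on nat with time set [0, +oo[ is
   given by its one-dimensional laws m t = Law(X(t)) and its transition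
   probabilities p s t x A = P(X(t) \in A | X(s) = x) for 0 <= s <= t (values
   at other times are irrelevant).  It is nonlinear: the rates at time t depend
   on m t.  With f the indicator of {y}, generator f x is the rate of the jump
   x -> y if y <> x, and minus the total jump rate out of x if y = x.  The
   continuity in t of the transition probabilities rules out jumps at
   deterministic times, which the one-sided rates alone would not see. *)
Record nonlinear_process (R : realType) (delta lambda : R)
    (m : R -> probability nat R) (p : R -> R -> nat -> probability nat R)
    : Prop := NonlinearProcess {
  np_diag : forall (s : R) x A, 0 <= s -> p s s x A = \d_x A ;
  np_chapman_kolmogorov : forall (s t u : R) x A, 0 <= s -> s <= t -> t <= u ->
    p s u x A = (\int[p s t x]_z p t u z A)%E ;
  np_law : forall (s t : R) A, 0 <= s -> s <= t ->
    m t A = (\int[m s]_x p s t x A)%E ;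
  np_continuous : forall (s : R) x y, 0 <= s ->
    {within `[s, +oo[, continuous (fun t : R => fine (p s t x [set y]))} ;
  np_rates : forall (t : R) x y, 0 <= t ->
    (fine (p t (t + h) x [set y]) - (x == y)%:R) / h @[h --> 0^'+]
      --> generator delta lambda (m t) (fun z => (z == y)%:R) x
}.

(* The first conjunct, existence of the process started from mu, ensures that
   the second one is not vacuous. *)
Definition stationary_distribution (R : realType) (delta lambda : R)
    (mu : probability nat R) : Prop :=
  (exists m p, nonlinear_process delta lambda m p /\ m 0 =1 mu) /\
  (forall m p, nonlinear_process delta lambda m p -> m 0 =1 mu ->
     forall t : R, 0 <= t -> m t =1 mu).

(* Main.v *)
Require Import Defs.
From HB Require Import structures.
From mathcomp Require Import all_boot all_order all_algebra.
From mathcomp Require Import all_classical all_reals all_analysis.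
From mathcomp Require Import ring lra.
Set Implicit Arguments.
Unset Strict Implicit.
Unset Printing Implicit Defensive.
Import Order.TTheory GRing.Theory Num.Theory.
Import numFieldNormedType.Exports.
Local Open Scope classical_set_scope.
Local Open Scope ring_scope.

(** Write F(x) = mu[0,x).  A law is stationary for the nonlinear process exactly
when it satisfies detailed balance, (1 + delta) mu(n) = (1 + lambda F(n+1)) mu(n+1)
for all n, and the theorem combines a study of this recursion with a proof of
that equivalence.

Solving detailed balance.  Summing the balance equations and using
2 F(k) mu(k) = F(k+1)^2 - F(k)^2 - mu(k)^2 gives [detailed_balance_sum]:
(1 + delta) F(n) = F(n+1) - mu(0) + (lambda/2) (F(n+1)^2 - sum_(k <= n) mu(k)^2).
If F tends to 1 the limit reads delta + mu(0) = (lambda/2) (1 - sum mu(k)^2), so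
lambda <= 2 delta forces mu(0) = 0, hence mu = 0 [no_detailed_balance].
Conversely the recursion has one solution for each initial value p = mu(0), and
existence is a shooting argument in p [detailed_balance_ex].  A maximum
principle gives lambda mu(n) <= delta + lambda p; inserted in the identity, it
shows that the total mass is below 1 for small p as soon as lambda > 3 delta.
At the supremum c of the values p > 0 whose total mass is at most 1, the total
mass is exactly 1: the mass at c is at most 1 by continuity of the partial sums,
and if it were smaller, finitely many terms would witness, through an open
condition [trapped], that it stays at most 1 for p slightly above c.

From laws to balance.  The total jump rate is at most C = 2 + delta + lambda.  For
an arbitrary process with the prescribed rates, only pointwise right derivatives
at the current time are given; a Dini argument turns them into the uniform bound
P(X(t) = x | X(s) = x) >= 1 - C (t - s) [holding_probability].  This dominates
the difference quotients of the law, so that F_t(y) is Lipschitz in t and has the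
expected net flux between y-1 and y as right derivative [forward_equation].  A
constant law therefore has zero flux, which is detailed balance.  If instead the
initial law is balanced, then F_t - F_0 solves a Lipschitz system in the supremum
norm and starts at 0, so it vanishes [gronwall_family]: every process started
from a balanced law has constant law.

Existence of a process.  If the law is constant, the rates are frozen and the
generator is C (J - 1) for the transition operator J of a Markov chain.  The
semigroup is the Poisson mixture of the powers of J; the Chapman-Kolmogorov
relation follows from the same Gronwall lemma, and invariance of a balanced law
from a telescoping sum [stationary_process]. *)

(** * Comparison along right derivatives *)

(** A function whose lower right Dini derivative is nonnegative does not
decrease: the points of [a, b] where f stays above the line of slope -e from
(a, f a) form a closed set that can always be prolonged to the right, so its
supremum is b. *)
Lemma right_Dini_ge0_le (R : realType) (f : R -> R) (a b : R) : a <= b ->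
  {within `[a, b], continuous f} ->
  (forall t, a <= t < b -> forall e : R, 0 < e ->
     \forall h \near 0^'+, f t - e * h <= f (t + h)) ->
  f a <= f b.
Proof.
move=> ab cf Df.
suff H (e : R) : 0 < e -> f a - e * (b - a) <= f b.
  apply/ler_addgt0Pr => e e0.
  have ba1 : 0 < b - a + 1 by lra.
  have := H (e / (b - a + 1)) (divr_gt0 e0 ba1).
  have : e / (b - a + 1) * (b - a) <= e.
    by rewrite mulrAC ler_pdivrMr// ler_pM2l//; lra.
  lra.
move=> e0.
pose g t := f t + e * (t - a).
have cg : {within `[a, b], continuous g}.
  have ce : continuous (fun t : R => e * (t - a)).
    move=> x; apply: cvgM; first exact: cvg_cst.
    by apply: cvgB; [exact: cvg_id|exact: cvg_cst].
  move=> x; apply: cvgD; first exact: cf.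
  exact: (continuous_subspaceT ce).
pose T := [set t | t \in `[a, b] /\ f a <= g t].
have Ta : T a by split; rewrite ?in_itv/= ?lexx ?ab// /g subrr mulr0 addr0.
have supT : has_sup T.
  split; first by exists a.
  by exists b => t -[]; rewrite in_itv/= => /andP[].
pose c := sup T.
have ac : a <= c by apply: ub_le_sup => //; case: supT.
have cb : c <= b.
  by apply: ge_sup => [|t []]; [exists a|rewrite in_itv/= => /andP[]].
have cab : c \in `[a, b] by rewrite in_itv/= ac cb.
have Tc : T c.
  split=> //; rewrite leNgt; apply/negP => gc.
  have /subspace_continuousP /(_ c cab) /cvgrPdist_lt := cg.
  move=> /(_ (f a - g c)); rewrite subr_gt0 => /(_ gc) [d /= d0 Hd].
  have [t Tt ct] := sup_adherent d0 supT.
  have tc : t <= c by apply: ub_le_sup => //; case: supT.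
  case: Tt => tab ft.
  have ctd : ball_ Num.norm c d t.
    by rewrite /ball_/= ger0_norm ?subr_ge0// ltrBlDl addrC -ltrBlDl.
  have : `|g c - g t| < f a - g c := Hd t ctd tab.
  by rewrite ltr_norml => /andP[+ _]; move: ft gc; rewrite /g; lra.
suff cE : c = b.
  by move: Tc => []; rewrite cE /g; lra.
apply/eqP; rewrite eq_le cb/= leNgt; apply/negP => cb'.
have acb : a <= c < b by rewrite ac.
have Hc := Df c acb e e0.
near (0:R)^'+ => h.
have h0 : 0 < h by near: h; exact: nbhs_right_gt.
have hb : h < b - c by near: h; apply: nbhs_right_lt; rewrite subr_gt0.
have Th : f c - e * h <= f (c + h) by near: h.
have : c + h <= c.
  apply: ub_le_sup; first by case: supT.
  split; first by rewrite in_itv/=; lra.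
  by case: Tc => _; rewrite /g; lra.
lra.
Unshelve. all: by end_near. Qed.

(** The majorant c/2 e^(2kt) grows, by convexity of exp, at least at the rate
k c e^(2kt) that bounds the derivative of f; integrating a bound of size c thus
gains a factor 1/2, which is what makes the iteration in [gronwall_family]
converge. *)
Lemma right_derivative_bound (R : realType) (f d : R -> R) (k c : R) (T : R) :
  0 < k -> 0 <= c -> 0 <= T ->
  {within `[0, T], continuous f} -> f 0 = 0 ->
  (forall t, 0 <= t < T ->
     ((f (t + h) - f t) / h @[h --> 0^'+] --> d t) /\
     `|d t| <= k * (c * expR (2 * k * t))) ->
  f T <= c / 2 * expR (2 * k * T).
Proof.
move=> k0 c0 T0 cf f0 Hd.
pose g t := c / 2 * expR (2 * k * t) - f t.
have ck : 0 <= c / 2 by rewrite divr_ge0.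
suff : g 0 <= g T.
  by rewrite /g f0 mulr0 expR0; move: ck; lra.
apply: right_Dini_ge0_le => //.
  have ce : continuous (fun t : R => c / 2 * expR (2 * k * t)); last first.
    by move=> x; apply: cvgB; [exact: (continuous_subspaceT ce)|exact: cf].
  move=> x; apply: cvgM; first exact: cvg_cst.
  apply: (@continuous_comp _ _ _ (fun t => 2 * k * t) expR); last exact: continuous_expR.
  exact: mulrl_continuous.
move=> t tT e e0; have [/cvgrPdist_le /(_ _ e0) Ht dt] := Hd t tT.
near=> h.
have h0 : 0 < h by near: h; exact: nbhs_right_gt.
have : `|d t - (f (t + h) - f t) / h| <= e by near: h.
rewrite ler_norml => /andP[+ _].
rewrite lerBrDr -lerBrDl opprK ler_pdivrMr// => fth.
have dk : d t <= k * (c * expR (2 * k * t)) by apply: le_trans dt; exact: ler_norm.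
have E : expR (2 * k * t) * (1 + 2 * k * h) <= expR (2 * k * (t + h)).
  by rewrite [in leRHS]mulrDr expRD ler_pM2l ?expR_gt0// expR_ge1Dx.
have := ler_wpM2l ck E.
have := ler_wpM2r (ltW h0) dk.
rewrite /g; move: fth; lra.
Unshelve. all: by end_near. Qed.

(** Gronwall's lemma for a possibly infinite family of functions coupled through
their supremum only.  The supremum need not be continuous in t, which is why the
family is bounded by 2^-n e^(2kt) for every n rather than through an integral
inequality for the supremum. *)
Lemma gronwall_family (R : realType) (I : Type) (D d : I -> R -> R) (k : R) :
  0 < k -> (forall i (T : R), 0 <= T -> {within `[0, T], continuous (D i)}) ->
  (forall i, D i 0 = 0) -> (forall i t, 0 <= t -> `|D i t| <= 1) ->
  (forall i t, 0 <= t -> (D i (t + h) - D i t) / h @[h --> 0^'+] --> d i t) ->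
  (forall i t s, 0 <= t -> (forall j, `|D j t| <= s) -> `|d i t| <= k * s) ->
  forall i t, 0 <= t -> D i t = 0.
Proof.
move=> k0 cD D0 D1 dD dk.
have H n i t : 0 <= t -> `|D i t| <= 2 ^- n * expR (2 * k * t).
  elim: n i t => [|n IH] i t t0.
    rewrite expr0 invr1 mul1r (le_trans (D1 i t t0))//.
    rewrite (le_trans _ (expR_ge1Dx _))// lerDl mulr_ge0// mulr_ge0//; exact: ltW.
  have c0 : (0 : R) <= 2 ^- n by rewrite invr_ge0 exprn_ge0.
  rewrite exprSr invfM ler_norml; apply/andP; split; last first.
    apply: (right_derivative_bound k0 c0 t0 (cD i t t0) (D0 i) (d := d i)).
    move=> u /andP[u0 _].
    by split; [exact: dD|apply: dk => // j; exact: IH].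
  rewrite lerNl.
  apply: (@right_derivative_bound _ (fun u => - D i u) (fun u => - d i u)) => //.
  - by move=> x; apply: cvgN; exact: cD.
  - by rewrite D0 oppr0.
  move=> u /andP[u0 _]; split; last by rewrite normrN; apply: dk => // j; exact: IH.
  rewrite (_ : (fun h => _) = \- (fun h => (D i (u + h) - D i u) / h)).
    exact: cvgN (dD i u u0).
  by apply/funext => h /=; rewrite -mulNr opprB opprK addrC.
move=> i t t0; apply/eqP; rewrite -normr_le0.
have cv : (fun n => 2 ^- n * expR (2 * k * t)) @ \oo --> (0 : R).
  rewrite -[X in _ --> X](mul0r (expR (2 * k * t))).
  apply: cvgM; last exact: cvg_cst.
  have : `|2^-1 : R| < 1 by rewrite gtr0_norm ?invr_gt0// invf_lt1//; lra.
  move=> /cvg_expr.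
  rewrite (_ : GRing.exp (2^-1 : R) = (fun n => 2 ^- n))//.
  by apply/funext => n; exact: exprVn.
rewrite -(cvg_lim _ cv)//; apply: limr_ge; first by apply/cvg_ex; exists 0.
by apply: nearW => n; exact: H.
Qed.

(** * The detailed balance recursion *)

(** The partial sum [series w n.+1] is the mass below n.+1, so the right-hand
side is the death rate at n.+1 times its mass. *)
Definition detailed_balance (R : realType) (delta lambda : R) (w : R^nat) :=
  forall n, (1 + delta) * w n = (1 + lambda * series w n.+1) * w n.+1.

Lemma series0 (R : realType) (w : R^nat) : series w 0 = 0.
Proof. by rewrite /series/= big_geq. Qed.

Lemma series_ge0 (R : realType) (w : R^nat) n :
  (forall k, 0 <= w k) -> 0 <= series w n.
Proof. by move=> w0; exact: sumr_ge0. Qed.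

(** Sum of the balance equations up to n, doubled; the quadratic terms come from
2 F(k) w(k) = F(k+1)^2 - F(k)^2 - w(k)^2. *)
Lemma detailed_balance_sum (R : realType) (delta lambda : R) (w : R^nat) n :
  detailed_balance delta lambda w ->
  2 * ((1 + delta) * series w n) =
  2 * (series w n.+1 - w 0) +
  lambda * (series w n.+1 ^+ 2 - series (fun k => w k ^+ 2) n.+1).
Proof.
move=> bal; elim: n => [|n IH].
  by rewrite !seriesSr !series0; ring.
have -> : 2 * ((1 + delta) * series w n.+1) =
    2 * ((1 + delta) * series w n) + 2 * ((1 + delta) * w n).
  by rewrite seriesSr; ring.
by rewrite IH bal [series w n.+2]seriesSr [X in _ = _ + _ * (_ - X)]seriesSr; ring.
Qed.

(** Keeping only the term k = 0 of the sum of squares, the limit of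
[detailed_balance_sum] is 2 delta + 2 w(0) <= lambda (1 - w(0)^2).  With
lambda <= 2 delta this leaves w(0) <= 0, and the recursion propagates the
vanishing of w(0) to all w(n). *)
Lemma no_detailed_balance (R : realType) (delta lambda : R) (w : R^nat) :
  0 <= delta -> 0 <= lambda -> lambda <= 2 * delta -> (forall n, 0 <= w n) ->
  detailed_balance delta lambda w -> ~ (series w @ \oo --> (1 : R)).
Proof.
move=> d0 l0 ld w0 bal cw.
have cwS : (fun n => series w n.+1) @ \oo --> (1 : R) by rewrite cvg_shiftS.
have w01 : w 0 <= 1.
  rewrite -(cvg_lim _ cwS)//; apply: limr_ge; first by apply/cvg_ex; exists 1.
  apply: nearW => n; rewrite /series/= big_nat_recl// lerDl.
  exact: sumr_ge0.
pose u n := 2 * (series w n.+1 - w 0) + lambda * (series w n.+1 ^+ 2 - w 0 ^+ 2)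
            - 2 * ((1 + delta) * series w n).
have u0 n : 0 <= u n.
  have -> : u n = lambda * (series (fun k => w k ^+ 2) n.+1 - w 0 ^+ 2).
    by rewrite /u (detailed_balance_sum n bal); ring.
  rewrite mulr_ge0// subr_ge0.
  rewrite /series/= big_nat_recl// lerDl; apply: sumr_ge0 => i _.
  exact: sqr_ge0.
have cu : u @ \oo -->
    2 * (1 - w 0) + lambda * (1 ^+ 2 - w 0 ^+ 2) - 2 * ((1 + delta) * 1).
  apply: cvgB.
    apply: cvgD.
      by apply: cvgM; [exact: cvg_cst|apply: cvgB => //; exact: cvg_cst].
    apply: cvgM; first exact: cvg_cst.
    by apply: cvgB; [rewrite expr2; apply: cvgM|exact: cvg_cst].
  by apply: cvgM; [exact: cvg_cst|apply: cvgM => //; exact: cvg_cst].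
have : 0 <= 2 * (1 - w 0) + lambda * (1 ^+ 2 - w 0 ^+ 2) - 2 * ((1 + delta) * 1).
  rewrite -(cvg_lim _ cu)//; apply: limr_ge; first by apply/cvg_ex; eexists; exact: cu.
  exact: nearW.
have w02 : 0 <= 1 - w 0 ^+ 2 by rewrite subr_ge0 expr_le1.
have := ler_wpM2r w02 ld.
have := mulr_ge0 d0 (sqr_ge0 (w 0)).
rewrite expr1n => h1 h2 h3.
have w00 : w 0 = 0 by apply/eqP; rewrite eq_le w0 andbT; lra.
have wn n : w n = 0.
  elim: n => // n IH.
  have := bal n; rewrite IH mulr0 => /esym/eqP; rewrite mulf_eq0 => /orP[|/eqP//].
  by rewrite gt_eqF// ltr_pwDl// mulr_ge0// series_ge0.
have : series w @ \oo --> (0 : R).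
  rewrite (_ : series w = cst 0); first exact: cvg_cst.
  by apply/funext => n; rewrite /series/= big1.
by move=> /(cvg_lim (@Rhausdorff R)); rewrite (cvg_lim _ cw)// => /eqP; rewrite oner_eq0.
Qed.

(** * Existence of a balanced probability *)

Section shooting.
Variables (R : realType) (delta lambda : R).
Hypotheses (d0 : 0 <= delta) (l0 : 0 <= lambda).

(** Solution of the recursion with w(0) = p, carried together with its partial
sums so that each step is explicit. *)
Fixpoint profile (p : R) (n : nat) : R * R :=
  if n is n'.+1 then
    let: (F, w) := profile p n' in
    (F + w, (1 + delta) * w / (1 + lambda * (F + w)))
  else (0, p).

Definition weight (p : R) (n : nat) : R := (profile p n).2.

Lemma profile1E (p : R) n : (profile p n).1 = series (weight p) n.
Proof.
elim: n => [|n IH]; first by rewrite series0.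
by rewrite seriesSr -IH /weight /=; case: profile.
Qed.

Lemma weightS (p : R) n :
  weight p n.+1 = (1 + delta) * weight p n / (1 + lambda * series (weight p) n.+1).
Proof.
by rewrite seriesSr -profile1E /weight /=; case: profile.
Qed.

Lemma weight_ge0 (p : R) n : 0 <= p -> 0 <= weight p n.
Proof.
move=> p0; suff [] : 0 <= weight p n /\ 0 <= series (weight p) n by [].
elim: n => [|n [w0 F0]]; first by rewrite series0.
have F1 : 0 <= series (weight p) n.+1 by rewrite seriesSr addr_ge0.
split=> //; rewrite weightS divr_ge0// ?mulr_ge0// addr_ge0// mulr_ge0//.
Qed.

Lemma cumul_ge0 (p : R) n : 0 <= p -> 0 <= series (weight p) n.
Proof. by move=> p0; apply: series_ge0 => k; exact: weight_ge0. Qed.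

Lemma denom_gt0 (p : R) n : 0 <= p -> 0 < 1 + lambda * series (weight p) n.
Proof. by move=> p0; rewrite ltr_pwDl// mulr_ge0// cumul_ge0. Qed.

Lemma weight_balance (p : R) : 0 <= p -> detailed_balance delta lambda (weight p).
Proof.
by move=> p0 n; rewrite weightS [RHS]mulrC divfK// gt_eqF// denom_gt0.
Qed.

Lemma cumul_le (p : R) : 0 <= p ->
  {homo series (weight p) : m n / (m <= n)%N >-> m <= n}.
Proof.
move=> p0; apply: homo_leq => [//|a b c|n]; first exact: le_trans.
by rewrite seriesSr lerDl weight_ge0.
Qed.

(** Maximum principle.  Once lambda F >= delta the weights decrease; before that,
w(n) <= F(n+1) and the recursion map s |-> (1 + delta) s / (1 + s) sends [0, delta]
to itself, so lambda w(n+1) <= delta. *)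
Lemma weight_le (p : R) n : 0 <= p -> lambda * weight p n <= delta + lambda * p.
Proof.
move=> p0; have lp : 0 <= lambda * p by rewrite mulr_ge0.
elim: n => [|n IH]; first by rewrite /weight/= lerDr.
have B := weight_balance p0 n.
have w0 := weight_ge0 n p0; have w1 := weight_ge0 n.+1 p0.
have F0 := cumul_ge0 n p0; have S := seriesSr (weight p) n.
set F := series (weight p) n.+1 in B S *.
have [dF|Fd] := leP delta (lambda * F).
  apply: le_trans IH; apply: ler_wpM2l => //.
  rewrite -(@ler_pM2l _ (1 + delta)) ?ltr_pwDl//.
  by rewrite B ler_wpM2r// lerD2l.
suff : lambda * weight p n.+1 <= delta by lra.
have wF : lambda * weight p n <= lambda * F by rewrite ler_wpM2l// S lerDr.
have : (1 + lambda * F) * (lambda * weight p n.+1) <= (1 + lambda * F) * delta.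
  rewrite mulrCA -B mulrCA.
  have d1 : 0 <= 1 + delta by rewrite addr_ge0.
  have := ler_wpM2l d1 wF.
  lra.
by rewrite ler_pM2l// denom_gt0.
Qed.

(** With G = F(n+1), [weight_le] bounds the sum of squares by (delta + lambda p) G
over lambda, and [detailed_balance_sum] becomes
lambda G^2 <= (3 delta + lambda p) G + 2 p, which is impossible for G >= 1 and
small p. *)
Lemma cumul_lt1_small (p : R) n : 0 < p -> p * (lambda + 2) < lambda - 3 * delta ->
  series (weight p) n < 1.
Proof.
move=> p0 pl; have p0' := ltW p0.
suff : series (weight p) n.+1 < 1.
  by apply: le_lt_trans; apply: cumul_le.
have B := detailed_balance_sum n (weight_balance p0').
have FF : series (weight p) n <= series (weight p) n.+1 by apply: cumul_le.
have SQ : lambda * series (fun k => weight p k ^+ 2) n.+1 <=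
          (delta + lambda * p) * series (weight p) n.+1.
  rewrite /series/= !mulr_sumr; apply: ler_sum => i _.
  by rewrite expr2 mulrA ler_wpM2r ?weight_ge0// weight_le.
have wp : weight p 0 = p by [].
rewrite wp in B.
set G := series (weight p) n.+1 in B FF SQ *.
rewrite ltNge; apply/negP => G1.
have dF := ler_wpM2l d0 FF.
have G0 : 0 < G by lra.
have h1 : lambda * G ^+ 2 <= (3 * delta + lambda * p) * G + 2 * p by lra.
have pG : p <= p * G by rewrite ler_peMr.
have h2 : G * (p * (lambda + 2)) < G * (lambda - 3 * delta) by rewrite ltr_pM2l.
have h3 : lambda * G <= lambda * G ^+ 2 by rewrite ler_wpM2l// expr2 ler_peMr// ltW.
lra.
Qed.

(** A finite certificate that the total mass is at most 1.  Beyond n the ratio of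
successive weights is at most rho = (1 + delta) / (1 + lambda F(n)) < 1, and the
second condition is F(n) + w(n) / (1 - rho) < 1 cleared of denominators: the
geometric majorant of the tail keeps the mass below 1. *)
Definition trapped (p : R) n :=
  delta < lambda * series (weight p) n /\
  weight p n * (1 + lambda * series (weight p) n) <
  (1 - series (weight p) n) * (lambda * series (weight p) n - delta).

Lemma trapped_lt1 (p : R) n : 0 <= p -> trapped p n -> series (weight p) n.+1 < 1.
Proof.
move=> p0 [dF H]; rewrite seriesSr.
have w0 := weight_ge0 n p0.
set F := series _ n in dF H *; set w := weight p n in w0 H *.
have : w * (lambda * F - delta) < (1 - F) * (lambda * F - delta).
  apply: le_lt_trans H; rewrite ler_wpM2l//; have := d0; lra.
rewrite ltr_pM2r; lra.
Qed.

Lemma trappedS (p : R) n : 0 <= p -> trapped p n -> trapped p n.+1.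
Proof.
move=> p0 T; have F1 := trapped_lt1 p0 T; case: T => dF H.
have w0 := weight_ge0 n p0; have B := weight_balance p0 n.
have lw := mulr_ge0 l0 w0.
rewrite /trapped [weight p n.+1 * _]mulrC -B; rewrite seriesSr in F1 *.
set F := series _ n in dF H F1 *; set w := weight p n in w0 H F1 lw *.
split; first by lra.
have : 0 <= (1 - (F + w)) * (lambda * w) by rewrite mulr_ge0// subr_ge0 ltW.
lra.
Qed.

Lemma trapped_bounded (p : R) n m : 0 <= p -> trapped p n -> series (weight p) m <= 1.
Proof.
move=> p0 T.
have Tk k : trapped p (n + k).
  by elim: k => [|k IH]; rewrite ?addn0// addnS; exact: trappedS.
apply: le_trans (ltW (trapped_lt1 p0 (Tk m))).
by apply: cumul_le => //; rewrite leqW// leq_addl.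
Qed.

(** Each term depends continuously on p; no continuity of the total mass is
claimed, the open condition [trapped] replaces it. *)
Lemma weight_continuous n (p : R) : 0 <= p ->
  {for p, continuous (fun q => weight q n)} /\
  {for p, continuous (fun q => series (weight q) n)}.
Proof.
move=> p0; elim: n => [|n [cw cF]].
  split; first exact: cvg_id.
  rewrite (_ : (fun q => _) = cst 0); first exact: cvg_cst.
  by apply/funext => q; exact: series0.
have cF1 : {for p, continuous (fun q => series (weight q) n.+1)}.
  rewrite (_ : (fun q => _) = (fun q => series (weight q) n + weight q n)).
    exact: cvgD.
  by apply/funext => q; exact: seriesSr.
split=> //; rewrite (_ : (fun q => _) = (fun q => (1 + delta) * weight q n /
    (1 + lambda * series (weight q) n.+1))); last first.
  by apply/funext => q; exact: weightS.
apply: cvgM; first by apply: cvgM => //; exact: cvg_cst.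
apply: cvgV; first by rewrite gt_eqF// denom_gt0.
by apply: cvgD; [exact: cvg_cst|apply: cvgM => //; exact: cvg_cst].
Qed.

Lemma trapped_near (p : R) n : 0 <= p -> trapped p n -> \forall q \near p, trapped q n.
Proof.
move=> p0 [h1 h2]; have [cw cF] := weight_continuous n p0.
have cl : (fun q => lambda * series (weight q) n) q @[q --> p] -->
    lambda * series (weight p) n by apply: cvgM => //; exact: cvg_cst.
have c1 : (fun q => lambda * series (weight q) n - delta) q @[q --> p] -->
    lambda * series (weight p) n - delta by apply: cvgB => //; exact: cvg_cst.
have c2 : ((fun q => (1 - series (weight q) n) * (lambda * series (weight q) n - delta)
   - weight q n * (1 + lambda * series (weight q) n)) q) @[q --> p] -->
   ((1 - series (weight p) n) * (lambda * series (weight p) n - delta)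
   - weight p n * (1 + lambda * series (weight p) n)).
  apply: cvgB; apply: cvgM => //.
    by apply: cvgB => //; exact: cvg_cst.
  by apply: cvgD => //; exact: cvg_cst.
near=> q; split; rewrite -subr_gt0; near: q.
  by apply: (cvgr_gt _ c1); rewrite subr_gt0.
by apply: (cvgr_gt _ c2); rewrite subr_gt0.
Unshelve. all: by end_near. Qed.

(** If the mass L is below 1, the weights tend to 0 while the products in
[trapped] tend to (1 - L)(lambda L - delta).  This is positive: lambda L <= delta
would make the weights nondecreasing, hence bounded below by p > 0. *)
Lemma trapped_ex (p : R) : 0 < p -> (forall n, series (weight p) n <= 1) ->
  ~ (series (weight p) @ \oo --> (1 : R)) -> exists n, trapped p n.
Proof.
move=> p0 F1 ncv; have p0' := ltW p0.
have nd := cumul_le p0'.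
have cv : cvgn (series (weight p)).
  by apply: (nondecreasing_is_cvgn nd); exists 1 => _ [n _ <-].
set L := limn (series (weight p)).
have cvL : series (weight p) @ \oo --> L by exact: cv.
have L1 : L <= 1 by apply: limr_le => //; exact: nearW.
have {}L1 : L < 1.
  by rewrite lt_neqAle L1 andbT; apply/eqP => LE; apply: ncv; rewrite -LE.
have FL n : series (weight p) n <= L by exact: nondecreasing_cvgn_le.
have cw : weight p @ \oo --> (0 : R) by exact: cvg_series_cvg_0.
have dL : delta < lambda * L.
  rewrite ltNge; apply/negP => Ld.
  have wp n : p <= weight p n.
    elim: n => // n IH; apply: (le_trans IH).
    have := weight_balance p0' n.
    have w1 := weight_ge0 n.+1 p0'.
    have := ler_wpM2l l0 (FL n.+1) => lF B.
    have : lambda * series (weight p) n.+1 <= delta by lra.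
    move=> /(ler_wpM2r w1) h.
    have : (1 + delta) * weight p n <= (1 + delta) * weight p n.+1 by lra.
    by rewrite ler_pM2l// ltr_pwDl.
  have : p <= 0; last by lra.
  rewrite -(cvg_lim _ cw)//; apply: limr_ge; first by apply/cvg_ex; exists 0.
  exact: nearW.
have c1 : (fun n => lambda * series (weight p) n - delta) @ \oo --> lambda * L - delta.
  by apply: cvgB; [apply: cvgM => //; exact: cvg_cst|exact: cvg_cst].
have c2 : (fun n => (1 - series (weight p) n) * (lambda * series (weight p) n - delta)
   - weight p n * (1 + lambda * series (weight p) n)) @ \oo -->
   ((1 - L) * (lambda * L - delta) - 0 * (1 + lambda * L)).
  apply: cvgB; apply: cvgM => //.
    by apply: cvgB => //; exact: cvg_cst.
  by apply: cvgD; [exact: cvg_cst|apply: cvgM => //; exact: cvg_cst].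
near \oo => n; exists n; split; rewrite -subr_gt0; near: n.
  by apply: (cvgr_gt _ c1); rewrite subr_gt0.
by apply: (cvgr_gt _ c2); rewrite mul0r subr0 mulr_gt0// subr_gt0.
Unshelve. all: by end_near. Qed.

(** Shooting: the supremum of the initial values of mass at most 1 has mass
exactly 1. *)
Lemma detailed_balance_ex : 3 * delta < lambda ->
  exists w : R^nat, [/\ forall n, 0 <= w n, detailed_balance delta lambda w &
    series w @ \oo --> (1 : R)].
Proof.
move=> ld; have hd := d0; have hl := l0.
pose S := [set p | 0 < p /\ forall n, series (weight p) n <= 1].
(* half of the threshold in [cumul_lt1_small] *)
pose p0 := (lambda - 3 * delta) / (lambda + 2) / 2.
have Sp0 : S p0.
  have l2 : 0 < lambda + 2 by lra.
  have h : 0 < (lambda - 3 * delta) / (lambda + 2) by rewrite divr_gt0//; lra.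
  split; first by rewrite divr_gt0.
  move=> n; apply/ltW/cumul_lt1_small; first by rewrite divr_gt0.
  rewrite /p0 mulrAC divfK ?gt_eqF//; lra.
have Sp1 p : S p -> p <= 1.
  by move=> [_ /(_ 1)]; rewrite seriesSr series0 add0r.
have supS : has_sup S by split; [exists p0|exists 1].
pose c := sup S.
have cS p : S p -> p <= c by move=> Sp; apply: ub_le_sup => //; case: supS.
have c0 : 0 < c by apply: lt_le_trans (cS _ Sp0); case: Sp0.
have Sc n : series (weight c) n <= 1.
  rewrite leNgt; apply/negP => F1.
  have [_ /cvgr_gt /(_ _ F1) [e /= e0 He]] := weight_continuous n (ltW c0).
  have [p Sp cp] := sup_adherent e0 supS.
  have : 1 < series (weight p) n.
    apply: He; rewrite /ball_/= ger0_norm ?subr_ge0 ?cS//.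
    by rewrite ltrBlDl addrC -ltrBlDl.
  by rewrite ltNge; case: Sp => _ ->.
exists (weight c); split.
- by move=> n; apply: weight_ge0; exact: ltW.
- exact: weight_balance (ltW c0).
apply: contrapT => /(trapped_ex c0 Sc) [n /(trapped_near (ltW c0)) Tn].
near (c^'+) => p.
have cp : c < p by near: p; exact: nbhs_right_gt.
have Tp : trapped p n by near: p; exact: cvg_within Tn.
have : p <= c; last by rewrite leNgt cp.
apply: cS; split; first exact: lt_trans cp.
by move=> m; apply: trapped_bounded Tp; rewrite ltW// (lt_trans c0).
Unshelve. all: by end_near. Qed.

End shooting.

(** * Probability measures on the natural numbers *)

Section probability_nat.
Variable R : realType.
Implicit Types P Q : probability nat R.

Lemma fineK_prob P A : (fine (P A))%:E = P A.
Proof. by rewrite fineK// fin_num_measure. Qed.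

Lemma prob_ge0 P A : 0 <= fine (P A).
Proof. by rewrite -lee_fin fineK_prob. Qed.

Lemma prob_le P A B : A `<=` B -> fine (P A) <= fine (P B).
Proof.
by move=> AB; rewrite -lee_fin !fineK_prob; apply: le_measure; rewrite ?inE.
Qed.

Lemma prob_le1 P A : fine (P A) <= 1.
Proof. by rewrite -lee_fin fineK_prob probability_le1. Qed.

Lemma probU P A B : A `&` B = set0 -> fine (P (A `|` B)) = fine (P A) + fine (P B).
Proof.
by move=> AB; apply: EFin_inj; rewrite EFinD !fineK_prob measureU.
Qed.

Lemma prob_initialS P n : fine (P `I_n.+1) = fine (P `I_n) + fine (P [set n]).
Proof.
rewrite -probU; first by rewrite IIS.
by apply/seteqP; split=> // x /= [+ xn]; rewrite xn ltnn.
Qed.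

Lemma prob_initial P n : fine (P `I_n) = \sum_(i < n) fine (P [set (i : nat)]).
Proof.
elim: n => [|n IH]; last by rewrite big_ord_recr/= -IH prob_initialS.
by rewrite big_ord0 II0 measure0.
Qed.

Lemma prob_nat_ext P Q :
  (forall n, fine (P `I_n) = fine (Q `I_n)) -> P =1 Q.
Proof.
move=> PQ A.
have PQ1 n : P [set n] = Q [set n].
  rewrite -fineK_prob -[RHS]fineK_prob; congr EFin.
  by have := PQ n.+1; rewrite !prob_initialS PQ => /addrI.
have -> : A = \bigcup_(n in A) [set n].
  by apply/seteqP; split=> [x Ax|x [n An ->//]]; exists x.
have tr : trivIset A (fun n => [set n]) by move=> i j _ _ [x [/= -> ->]].
rewrite !measure_bigcup//.
by apply: eq_eseriesr => n _; exact: PQ1.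
Qed.

Lemma bounded_integrable P (f : nat -> R) (M : R) :
  (forall x, `|f x| <= M) -> P.-integrable setT (EFin \o f).
Proof.
move=> fM; apply: measurable_bounded_integrable => //.
  by rewrite (le_lt_trans (probability_le1 P _))// ltry.
exists M; split; first exact: num_real.
by move=> r Mr x _ /=; rewrite (le_trans (fM x))// ltW.
Qed.

Lemma indicator_integrable P (A : set nat) :
  P.-integrable setT (EFin \o (fun z : nat => (z \in A)%:R : R)).
Proof.
apply: (@bounded_integrable _ _ 1) => z.
by case: (_ \in _); rewrite ?normr1 ?normr0.
Qed.

Lemma Rintegral_set P (A : set nat) :
  \int[P]_z (z \in A)%:R = fine (P A).
Proof.
by rewrite /Rintegral (integral_indic P measurableT (A := A))// setIT.
Qed.

Lemma cvg_Rintegral_seq P (f : nat -> nat -> R) (g : nat -> R) (M : R) :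
  (forall n x, `|f n x| <= M) -> (forall x, f ^~ x @ \oo --> g x) ->
  (fun n => \int[P]_x (f n x)) @ \oo --> \int[P]_x (g x).
Proof.
move=> fM fg.
have gM x : `|g x| <= M.
  have cg : (fun n => `|f n x|) @ \oo --> `|g x| by exact: cvg_norm.
  rewrite -(cvg_lim _ cg)//; apply: limr_le; first by apply/cvg_ex; eexists; exact: cg.
  exact: nearW.
have [| | | | |_ _] := @dominated_convergence _ _ _ P setT measurableT
   (fun n => EFin \o f n) (EFin \o g) (EFin \o cst M).
- by [].
- by [].
- by apply: aeW => x _ /=; apply: cvg_EFin; [exact: nearW|exact: fg].
- by apply: (@bounded_integrable _ _ `|M|) => x /=.
- by apply: aeW => x n _ /=; rewrite lee_fin fM.
have ig : (\int[P]_x (EFin \o g) x = (\int[P]_x (g x))%:E)%E.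
  rewrite /Rintegral fineK//; apply: integrable_fin_num => //.
  exact: bounded_integrable gM.
by rewrite ig => /fine_cvgP[].
Qed.

Lemma cvg_Rintegral P (f : R -> nat -> R) (g : nat -> R) (M : R) :
  (forall (h : R) x, 0 < h -> `|f h x| <= M) ->
  (forall x, f h x @[h --> 0^'+] --> g x) ->
  \int[P]_x (f h x) @[h --> 0^'+] --> \int[P]_x (g x).
Proof.
move=> fM fg; apply/cvg_at_rightP => u [u0 cu].
apply: (@cvg_Rintegral_seq _ (fun n => f (u n)) _ M) => [n x|x]; first exact: fM.
by have /cvg_at_rightP := fg x; apply.
Qed.

Lemma Rintegral_norm_le P (f : nat -> R) (M : R) :
  (forall x, `|f x| <= M) -> `|\int[P]_x (f x)| <= M.
Proof.
move=> fM; have M0 : 0 <= M by exact: le_trans (fM 0%N).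
apply: (le_trans (le_normr_Rintegral measurableT (bounded_integrable P fM))).
have -> : M = \int[P]_(x in setT) M.
  rewrite Rintegral_cst// (_ : fine _ = 1) ?mulr1//.
  exact: (congr1 fine (probability_setT P)).
apply: le_Rintegral => //.
  by apply: (@bounded_integrable _ _ M) => x; rewrite normr_id.
by apply: (@bounded_integrable _ _ M) => x; rewrite ger0_norm.
Qed.

Lemma Rintegral_ge_pt P (f : nat -> R) (M : R) x :
  (forall z, 0 <= f z <= M) -> f x * fine (P [set x]) <= \int[P]_z (f z).
Proof.
move=> fM; rewrite -Rintegral_set -RintegralZl//; last exact: indicator_integrable.
apply: le_Rintegral => //.
- apply: (@bounded_integrable _ _ M) => z; have /andP[f0 f1] := fM x.
  rewrite ger0_norm ?mulr_ge0//; case: (_ \in _); rewrite ?mulr1// mulr0.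
  exact: le_trans f1.
- apply: (@bounded_integrable _ _ M) => z.
  by have /andP[f0 f1] := fM z; rewrite ger0_norm.
move=> z _; have /andP[f0 f1] := fM z; have [/set_mem/= ->|_] := boolP (z \in _).
  by rewrite mulr1.
by rewrite mulr0.
Qed.

End probability_nat.

Lemma series_prob (R : realType) (mu : probability nat R) n :
  series (fun k => fine (mu [set k])) n = fine (mu `I_n).
Proof. by rewrite prob_initial /series/= big_mkord. Qed.

Lemma cvg_prob_initial (R : realType) (mu : probability nat R) :
  series (fun k => fine (mu [set k])) @ \oo --> (1 : R).
Proof.
have nd : nondecreasing_seq (fun n => `I_n : set nat).
  by move=> a b ab; apply/subsetPset => x /= /leq_trans; exact.
have cv : (fun n => mu `I_n) @ \oo --> 1%E.
  rewrite -(probability_setT mu) (_ : setT = \bigcup_n `I_n).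
    exact: nondecreasing_cvg_mu.
  by apply/seteqP; split=> // n _; exists n.+1 => //=.
have /fine_cvgP[_] := cv; apply: cvg_trans.
rewrite (_ : _ \o _ = series (fun k => fine (mu [set k])))//.
by apply/funext => n; rewrite series_prob.
Qed.

Section unit_mass.
Variables (R : realType) (m : {measure set nat -> \bar R}).
Hypothesis m1 : m setT = 1%E.

(** The proof of unit mass is an argument of this otherwise trivial wrapper so
that the probability structure can be attached to it. *)
Definition unit_mass_measure of m setT = 1%E : set nat -> \bar R := m.

HB.instance Definition _ := Measure.copy (unit_mass_measure m1) m.
HB.instance Definition _ :=
  Measure_isProbability.Build _ _ _ (unit_mass_measure m1) m1.

Definition unit_mass_probability : probability nat R := unit_mass_measure m1.

End unit_mass.

Section weights.
Variables (R : realType) (w : R^nat).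
Hypothesis w0 : forall n, 0 <= w n.
Hypothesis w1 : series w @ \oo --> (1 : R).

Let m := mseries (fun n =>
  mscale (NngNum (w0 n)) (\d_n : {measure set nat -> \bar R})) 0.

Let mE A u : (forall n, w n * (n \in A)%:R = u n) ->
  forall l : R, series u @ \oo --> l -> m A = l%:E.
Proof.
move=> uE l ul; rewrite /m /mseries.
rewrite (eq_eseriesr (g := EFin \o u)); last first.
  by move=> n _; rewrite /= /mscale/= diracE -EFinM uE.
rewrite -(cvg_lim _ ul)// -EFin_lim; last by apply/cvg_ex; eexists; exact: ul.
by congr (limn _); apply/funext => n; rewrite /= /series/= -sumEFin.
Qed.

Lemma probability_of_weights : exists mu : probability nat R,
  forall n, fine (mu [set n]) = w n.
Proof.
have m1 : m setT = 1%E by apply: (mE (u := w)) => // n; rewrite mem_setT mulr1.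
exists (unit_mass_probability m1) => n; apply: EFin_inj; rewrite fineK_prob.
apply: (mE (u := fun k => w k * (k \in [set n])%:R)) => //.
apply: cvg_near_cst; near=> N; have nN : (n < N)%N by near: N; exact: nbhs_infty_gt.
rewrite /series/= big_mkord (bigD1 (Ordinal nN))//= mem_set// mulr1 big1 ?addr0//.
move=> i /eqP iN; rewrite memNset ?mulr0//= => iE; apply: iN; exact: val_inj.
Unshelve. all: by end_near. Qed.

End weights.

Lemma Rintegral_series (R : realType) (mu : probability nat R) (g : nat -> R)
    (M : R) : (forall z, `|g z| <= M) ->
  series (fun n => g n * fine (mu [set n])) @ \oo --> \int[mu]_z (g z).
Proof.
move=> gM.
have E n : \int[mu]_z (g z * (z < n)%N%:R) = series (fun n => g n * fine (mu [set n])) n.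
  elim: n => [|n IH].
    rewrite series0 (_ : (fun z : nat => _) = cst 0).
      by rewrite Rintegral_cst// mul0r.
    by apply/funext => z; rewrite mulr0.
  rewrite seriesSr -IH -Rintegral_set -RintegralZl//; last exact: indicator_integrable.
  have gk (b : nat -> bool) : forall z, `|g z * (b z)%:R| <= M.
    move=> z; rewrite normrM; apply: le_trans (gM z); case: (b z);
    by rewrite ?normr1 ?normr0 ?mulr1// mulr0.
  rewrite -RintegralD//.
  - congr fine; apply: eq_integral => z _ /=; congr EFin.
    rewrite ltnS leq_eqVlt; have [->|zn] := eqVneq z n.
      by rewrite ltnn mem_set//= mulr0 add0r.
    by rewrite memNset/= ?mulr0 ?addr0//; exact/eqP.
  - exact: bounded_integrable (gk (fun z => (z < n)%N)).
  - apply: (@bounded_integrable _ _ _ M) => z.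
    apply: le_trans (gM n); rewrite normrM; case: (_ \in _);
    by rewrite ?normr1 ?normr0 ?mulr1// mulr0.
have := @cvg_Rintegral_seq _ mu (fun n z => g z * (z < n)%N%:R) g M.
rewrite (_ : (fun n => _) = series (fun n => g n * fine (mu [set n])));
  last exact/funext.
apply.
  move=> n z; rewrite normrM; apply: le_trans (gM z); case: (_ < _)%N;
  by rewrite ?normr1 ?normr0 ?mulr1// mulr0.
move=> z; apply: (@cvg_near_cst) => //.
near=> n; have zn : (z < n)%N by near: n; exact: nbhs_infty_gt.
by rewrite zn mulr1.
Unshelve. all: by end_near. Qed.

(** * Poisson means of bounded sequences *)

Section poisson_mean.
Variable R : realType.
Implicit Types (a b : R^nat) (t M : R).

Definition poisson_weight t n := expR (- t) * t ^+ n / n`!%:R.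

(** The expectation of a(N) for N a Poisson variable of parameter t.  The factor
exp(-t) is kept outside the sum so that the rest is a power series in t. *)
Definition poisson_mean a t := expR (- t) * limn (pseries (fun n => a n / n`!%:R) t).

Lemma is_cvg_poisson a M t : (forall n, `|a n| <= M) ->
  cvgn (pseries (fun n => a n / n`!%:R) t).
Proof.
move=> aM; apply: normed_cvg.
have M0 : 0 <= M := le_trans (normr_ge0 _) (aM 0%N).
apply: (@series_le_cvg _ _ (M *: exp_coeff `|t|)) => [n|n|n|].
- exact: normr_ge0.
- by rewrite mulr_ge0// divr_ge0// exprn_ge0.
- rewrite /= mulrAC -mulrA normrM normf_div normrX normr_nat.
  by apply: ler_wpM2r => //; rewrite divr_ge0// exprn_ge0.
- exact/is_cvg_seriesZ/is_cvg_series_exp_coeff.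
Qed.

Lemma poisson_weight_ge0 t n : 0 <= t -> 0 <= poisson_weight t n.
Proof.
by move=> t0; rewrite divr_ge0// mulr_ge0 ?expR_ge0// exprn_ge0.
Qed.

Lemma cvg_poisson_mean a M t : (forall n, `|a n| <= M) ->
  series (fun n => poisson_weight t n * a n) @ \oo --> poisson_mean a t.
Proof.
move=> aM; rewrite (_ : series _ =
    (fun n => expR (- t) * pseries (fun n => a n / n`!%:R) t n)).
  by apply: cvgM; [exact: cvg_cst|exact: is_cvg_poisson aM].
apply/funext => n; rewrite /pseries/= /series/= mulr_sumr.
by apply: eq_bigr => i _; rewrite /poisson_weight; ring.
Qed.

Lemma poisson_mean0 a : poisson_mean a 0 = a 0%N.
Proof.
rewrite /poisson_mean oppr0 expR0 mul1r; apply: lim_near_cst => //.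
near=> n; have n0 : (0 < n)%N by near: n; exact: nbhs_infty_gt.
rewrite /pseries/= /series/= -(prednK n0) big_nat_recl// expr0 mulr1 fact0 divr1.
by rewrite big1 ?addr0// => i _; rewrite expr0n mulr0.
Unshelve. all: by end_near. Qed.

Lemma poisson_mean_cst (k t : R) : poisson_mean (cst k) t = k.
Proof.
rewrite /poisson_mean (_ : pseries _ t = series (k *: exp_coeff t)).
  rewrite lim_seriesZ; last exact: is_cvg_series_exp_coeff.
  by rewrite -/(expR t) [LHS]mulrCA -expRD addNr expR0 mulr1.
by apply/funext => n; apply: eq_bigr => i _; rewrite /= mulrAC -mulrA.
Qed.

Lemma poisson_meanD a b M t :
  (forall n, `|a n| <= M) -> (forall n, `|b n| <= M) ->
  poisson_mean (fun n => a n + b n) t = poisson_mean a t + poisson_mean b t.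
Proof.
move=> aM bM; rewrite /poisson_mean -mulrDr -lim_seriesD.
- congr (_ * _); congr (limn _); apply/funext => n; apply: eq_bigr => i _.
  by rewrite /= !mulrDl.
- exact: is_cvg_poisson aM.
- exact: is_cvg_poisson bM.
Qed.

Lemma poisson_meanZ a (k M t : R) : (forall n, `|a n| <= M) ->
  poisson_mean (fun n => k * a n) t = k * poisson_mean a t.
Proof.
move=> aM; rewrite /poisson_mean mulrCA -[k * limn _]lim_seriesZ.
  congr (_ * _); congr (limn _); apply/funext => n; apply: eq_bigr => i _.
  by rewrite /= -[RHS]/(k * (a i / i`!%:R * t ^+ i)) !mulrA.
exact: is_cvg_poisson aM.
Qed.

Lemma poisson_mean_ge0 a M t : 0 <= t -> (forall n, 0 <= a n <= M) ->
  0 <= poisson_mean a t.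
Proof.
move=> t0 aM; rewrite mulr_ge0 ?expR_ge0//; apply: limr_ge.
  apply: (@is_cvg_poisson _ M) => n; have /andP[a0 a1] := aM n.
  by rewrite ger0_norm.
apply: nearW => n; apply: sumr_ge0 => i _; have /andP[a0 _] := aM i.
by rewrite mulr_ge0 ?exprn_ge0// divr_ge0.
Qed.

Lemma poisson_mean01 a t : 0 <= t -> (forall n, 0 <= a n <= 1) ->
  0 <= poisson_mean a t <= 1.
Proof.
move=> t0 a01; apply/andP; split; first exact: poisson_mean_ge0 a01.
have a1 n : `|a n| <= 1 by have /andP[a0 ?] := a01 n; rewrite ger0_norm.
rewrite -subr_ge0 -[X in X - _](poisson_mean_cst 1 t) -mulN1r.
rewrite -(poisson_meanZ _ _ a1) -(@poisson_meanD _ _ 1).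
- apply: (@poisson_mean_ge0 _ 1) => // n; have /andP[a0 a2] := a01 n.
  by rewrite /= mulN1r; lra.
- by move=> n; rewrite normr1.
- by move=> n; rewrite mulN1r normrN.
Qed.

(** Differentiating the power series shifts the sequence, the derivative of
exp(-t) subtracts the mean itself. *)
Lemma is_derive_poisson_mean a M t : (forall n, `|a n| <= M) ->
  is_derive t 1 (poisson_mean a)
    (poisson_mean (fun n => a n.+1) t - poisson_mean a t).
Proof.
move=> aM.
have dE b : pseries_diffs (fun n => b n / n`!%:R) = (fun n => b n.+1 / n`!%:R) :> R^nat.
  apply/funext => n; rewrite /pseries_diffs factS natrM.
  rewrite mulrCA; congr (_ * _).
  by rewrite invfM mulrA divff ?mul1r// pnatr_eq0.
have D1 : is_derive t 1 (fun u => limn (pseries (fun n => a n / n`!%:R) u))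
    (limn (pseries (fun n => a n.+1 / n`!%:R) t)).
  rewrite -dE; apply: (@pseries_snd_diffs _ _ (`|t| + 1)); rewrite ?dE.
  - exact: is_cvg_poisson aM.
  - by apply: (@is_cvg_poisson _ M) => n.
  - by apply: (@is_cvg_poisson _ M) => n.
  - by rewrite [ltRHS]ger0_norm ?addr_ge0// ltrDl.
have D2 : is_derive t 1 (fun u : R => expR (- u)) (- expR (- t)).
  have := is_derive1_comp (is_derive_expR (- t)) (is_deriveN (is_derive_id t 1)).
  by rewrite mulrN1.
have := is_deriveM D2 D1.
rewrite /poisson_mean; set p := limn _; set q := limn _; set e := expR _ => H.
apply: (is_derive_eq H).
by rewrite /GRing.scale/=; ring.
Qed.

End poisson_mean.

Lemma is_derive_right (R : realType) (f : R -> R) (t d : R) :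
  is_derive t 1 f d -> (f (t + h) - f t) / h @[h --> 0^'+] --> d.
Proof.
move=> [df fd]; apply: cvg_dnbhs_at_right.
have : h^-1 *: (f (h *: 1 + t) - f t) @[h --> 0^'] --> 'D_1 f t by exact: df.
rewrite fd; apply: cvg_trans.
rewrite (_ : (fun h => h^-1 *: _) = (fun h => (f (t + h) - f t) / h))//.
apply/funext => h; rewrite [LHS]mulrC (_ : h *: 1 + t = t + h)//.
by rewrite /GRing.scale/= mulr1 addrC.
Qed.

(** * The birth-and-death semigroup with frozen rates *)

Section semigroup.
Variables (R : realType) (delta lambda : R) (mu : probability nat R).
Hypotheses (d0 : 0 <= delta) (l0 : 0 <= lambda).

(** An upper bound on the total jump rate (1 + delta) + (1 + lambda F(x)), used as
the uniformization rate. *)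
Definition rate_bound : R := 2 + delta + lambda.
Definition up : R := (1 + delta) / rate_bound.
Definition down (x : nat) : R :=
  (0 < x)%N%:R * (1 + lambda * fine (mu `I_x)) / rate_bound.
(** Transition operator of the uniformized chain: one potential jump, which is
rejected with the remaining probability. *)
Definition bd_jump (g : nat -> R) (x : nat) : R :=
  up * g x.+1 + down x * g x.-1 + (1 - up - down x) * g x.

Lemma rate_bound_gt0 : 0 < rate_bound.
Proof. by rewrite /rate_bound -addrA ltr_pwDl// addr_ge0. Qed.

Lemma rate_bound_ge0 : 0 <= rate_bound.
Proof. exact/ltW/rate_bound_gt0. Qed.

Lemma up_ge0 : 0 <= up.
Proof. by rewrite divr_ge0 ?addr_ge0// rate_bound_ge0. Qed.

Lemma down_ge0 x : 0 <= down x.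
Proof.
by rewrite divr_ge0 ?rate_bound_ge0// mulr_ge0// addr_ge0// mulr_ge0// prob_ge0.
Qed.

Lemma stay_ge0 x : 0 <= 1 - up - down x.
Proof.
rewrite -(@divff _ rate_bound) ?gt_eqF ?rate_bound_gt0// -!mulrBl.
rewrite divr_ge0 ?rate_bound_ge0// /rate_bound.
have hd := d0; have hl := l0; have F0 := prob_ge0 mu `I_x.
have lF : lambda * fine (mu `I_x) <= lambda by rewrite ler_piMr// prob_le1.
by case: (0 < x)%N; rewrite ?mulr1n ?mulr0n ?mul1r ?mul0r; lra.
Qed.

Lemma generator_jump g x :
  generator delta lambda mu g x = rate_bound * (bd_jump g x - g x).
Proof.
rewrite /generator /bd_jump /up /down; have := gt_eqF rate_bound_gt0.
move: (fine _) (0 < x)%N%:R rate_bound => F b C /negbT C0; field; exact: C0.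
Qed.

Lemma jump_norm (g : nat -> R) (M : R) : (forall x, `|g x| <= M) ->
  forall x, `|bd_jump g x| <= M.
Proof.
move=> gM x; rewrite /bd_jump.
have -> : M = up * M + down x * M + (1 - up - down x) * M by ring.
have H k z : 0 <= k -> `|k * g z| <= k * M.
  by move=> k0; rewrite normrM ger0_norm// ler_wpM2l.
rewrite (le_trans (ler_normD _ _))// lerD//; last exact/H/stay_ge0.
by rewrite (le_trans (ler_normD _ _))// lerD// H ?up_ge0 ?down_ge0.
Qed.

Lemma jump_ge0 (g : nat -> R) : (forall x, 0 <= g x) -> forall x, 0 <= bd_jump g x.
Proof.
by move=> g0 x; rewrite !addr_ge0// mulr_ge0 ?up_ge0 ?down_ge0 ?stay_ge0.
Qed.

Lemma iter_jump_norm n (g : nat -> R) (M : R) : (forall x, `|g x| <= M) ->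
  forall x, `|iter n bd_jump g x| <= M.
Proof. by move=> gM; elim: n => //= n; exact: jump_norm. Qed.

Lemma iter_jump_ge0 n (g : nat -> R) : (forall x, 0 <= g x) ->
  forall x, 0 <= iter n bd_jump g x.
Proof. by move=> gM; elim: n => //= n; exact: jump_ge0. Qed.

Lemma iter_jump01 n (g : nat -> R) : (forall x, 0 <= g x <= 1) ->
  forall x, 0 <= iter n bd_jump g x <= 1.
Proof.
move=> g01 x; have g0 z : 0 <= g z by have /andP[] := g01 z.
rewrite iter_jump_ge0//=; apply: le_trans (ler_norm _) _.
by apply: iter_jump_norm => z; rewrite ger0_norm//; have /andP[] := g01 z.
Qed.

(** Uniformization: the chain is run for a Poisson number of steps. *)
Definition bd_semigroup (t : R) (g : nat -> R) (x : nat) : R :=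
  poisson_mean (fun n => iter n bd_jump g x) (rate_bound * t).

Lemma semigroup0 g x : bd_semigroup 0 g x = g x.
Proof. by rewrite /bd_semigroup mulr0 poisson_mean0. Qed.

Lemma semigroup01 t (g : nat -> R) : 0 <= t -> (forall x, 0 <= g x <= 1) ->
  forall x, 0 <= bd_semigroup t g x <= 1.
Proof.
move=> t0 g01 x; apply: poisson_mean01 => [|n]; last exact: iter_jump01.
by rewrite mulr_ge0// rate_bound_ge0.
Qed.

(** Backward equation.  The Poisson derivative shifts the powers of the operator
by one, and one factor can be pulled out of the Poisson mean because it is a
finite combination of values. *)
Lemma is_derive_semigroup (g : nat -> R) (M t : R) x : (forall z, `|g z| <= M) ->
  is_derive t 1 (fun t => bd_semigroup t g x)
    (rate_bound * (bd_jump (bd_semigroup t g) x - bd_semigroup t g x)).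
Proof.
move=> gM.
have aM z n : `|iter n bd_jump g z| <= M by exact: iter_jump_norm.
have H1 := is_derive_poisson_mean (rate_bound * t) (aM x).
have H2 : is_derive t 1 (fun t => rate_bound * t) rate_bound.
  have := is_deriveZ rate_bound (is_derive_id t 1).
  by rewrite [_ *: 1]mulr1.
have := is_derive1_comp (f := poisson_mean (fun n => iter n bd_jump g x)) H1 H2.
rewrite /comp -/(bd_semigroup t g x) mulrC.
rewrite (_ : poisson_mean _ _ = bd_jump (bd_semigroup t g) x)//.
have kM z (k : R) n : `|k * iter n bd_jump g z| <= `|k| * M.
  by rewrite normrM ler_wpM2l.
rewrite /= /bd_jump.
pose K := `|up| * M + `|down x| * M + `|1 - up - down x| * M.
have M0 : 0 <= M by exact: le_trans (aM 0%N 0%N).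
rewrite (@poisson_meanD _ _ _ K); last 2 first.
- move=> n; rewrite (le_trans (ler_normD _ _))// /K -[leLHS]addr0.
  by rewrite lerD ?lerD ?mulr_ge0.
- move=> n; rewrite (le_trans (kM _ _ _))// /K lerDr addr_ge0// mulr_ge0//.
rewrite (@poisson_meanD _ _ _ K); last 2 first.
- by move=> n; rewrite (le_trans (kM _ _ _))// /K -addrA lerDl addr_ge0// mulr_ge0.
- move=> n; rewrite (le_trans (kM _ _ _))// /K addrAC lerDr addr_ge0// mulr_ge0//.
by rewrite !(@poisson_meanZ _ _ _ M).
Qed.

Lemma semigroup_continuous (g : nat -> R) (M : R) x : (forall z, `|g z| <= M) ->
  continuous (fun t => bd_semigroup t g x).
Proof.
move=> gM t; apply: differentiable_continuous; apply/derivable1_diffP.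
by have [] := is_derive_semigroup t x gM.
Qed.

(** Both sides solve the backward equation in t with the same value at t = 0, and
their difference is controlled by [gronwall_family]. *)
Lemma semigroupD (s t : R) (g : nat -> R) x : 0 <= s -> 0 <= t ->
  (forall z, 0 <= g z <= 1) ->
  bd_semigroup t (bd_semigroup s g) x = bd_semigroup (t + s) g x.
Proof.
move=> s0 t0 g01; apply/eqP; rewrite -subr_eq0; apply/eqP.
have b1 (f : nat -> R) : (forall z, 0 <= f z <= 1) -> forall z, `|f z| <= 1.
  by move=> f01 z; have /andP[f0 f1] := f01 z; rewrite ger0_norm.
have sg01 := semigroup01 s0 g01.
pose D z u := bd_semigroup u (bd_semigroup s g) z - bd_semigroup (u + s) g z.
have k0 : 0 < 2 * rate_bound by rewrite mulr_gt0// rate_bound_gt0.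
have CC := rate_bound_gt0.
apply: (@gronwall_family R nat D
  (fun z u => rate_bound * (bd_jump (D^~ u) z - D z u)) _ k0) => //.
- move=> i T _; apply: continuous_subspaceT => u; apply: cvgB.
    exact: (semigroup_continuous (b1 _ sg01)).
  apply: (@continuous_comp _ _ _ (fun u => u + s) (fun u => bd_semigroup u g i)).
    by apply: cvgD; [exact: cvg_id|exact: cvg_cst].
  exact: (semigroup_continuous (b1 _ g01)).
- by move=> i; rewrite /D semigroup0 add0r subrr.
- move=> i u u0; have /andP[? ?] := semigroup01 u0 sg01 i.
  have /andP[? ?] := semigroup01 (addr_ge0 u0 s0) g01 i.
  by rewrite /D ler_norml; apply/andP; split; lra.
- move=> i u u0.
  have H1 := is_derive_right (is_derive_semigroup u i (b1 _ sg01)).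
  have H2 := is_derive_right (is_derive_semigroup (u + s) i (b1 _ g01)).
  pose S := bd_semigroup.
  rewrite (_ : rate_bound * _ =
      rate_bound * (bd_jump (S u (S s g)) i - S u (S s g) i) -
      rate_bound * (bd_jump (S (u + s) g) i - S (u + s) g i)); last first.
    by rewrite /bd_jump /D /S; ring.
  rewrite (_ : (fun h => _) = (fun h =>
      (S (u + h) (S s g) i - S u (S s g) i) / h -
      (S (u + s + h) g i - S (u + s) g i) / h)).
    exact: cvgB H1 H2.
  by apply/funext => h; rewrite /D /S (addrAC u h s) -mulrBl; congr (_ / _); ring.
move=> i u r u0 Dr.
rewrite normrM gtr0_norm// -mulrA mulrCA ler_wpM2l ?rate_bound_ge0//.
rewrite (le_trans (ler_normB _ _))//.
have := jump_norm Dr i; have := Dr i; lra.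
Qed.

End semigroup.

Section kernels.
Variables (R : realType) (delta lambda : R) (mu : probability nat R).
Hypotheses (d0 : 0 <= delta) (l0 : 0 <= lambda).

Local Notation jump := (bd_jump delta lambda mu).
Local Notation semigroup := (bd_semigroup delta lambda mu).

(** The law of the chain after n steps from x, as a mixture over the first step;
countable additivity is inherited from the mixture. *)
Fixpoint jump_measure (n x : nat) : {measure set nat -> \bar R} :=
  if n is k.+1 then
    [the {measure set nat -> \bar R} of measure_add
      [the {measure set nat -> \bar R} of measure_add
        (mscale (NngNum (up_ge0 d0 l0)) (jump_measure k x.+1))
        (mscale (NngNum (down_ge0 mu d0 l0 x)) (jump_measure k x.-1))]
      (mscale (NngNum (stay_ge0 mu d0 l0 x)) (jump_measure k x))]
  else [the {measure set nat -> \bar R} of \d_x].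

Lemma integral_jump_measure n x (g : nat -> R) : (forall z, 0 <= g z) ->
  (\int[jump_measure n x]_z (g z)%:E = (iter n jump g x)%:E)%E.
Proof.
move=> g0; elim: n x => [|n IH] x /=.
  by rewrite integral_dirac// diracT mul1e.
have e0 z : [set: nat] z -> (0 <= (g z)%:E)%E by rewrite lee_fin.
rewrite ge0_integral_measure_add// ge0_integral_measure_add//.
rewrite !ge0_integral_mscale// !IH.
by rewrite -!EFinM -!EFinD.
Qed.

Lemma kernel_weight_ge0 (t : R) n :
  0 <= poisson_weight (rate_bound delta lambda * `|t|) n.
Proof. by rewrite poisson_weight_ge0// mulr_ge0// rate_bound_ge0. Qed.

(** The absolute value makes the Poisson weights nonnegative for every real t;
transition probabilities use it for t >= 0, but continuity in t then holds on the
whole line. *)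
Definition semigroup_measure (t : R) (x : nat) : {measure set nat -> \bar R} :=
  [the {measure set nat -> \bar R} of
    mseries (fun n => [the {measure set nat -> \bar R} of
      mscale (NngNum (kernel_weight_ge0 t n)) (jump_measure n x)]) 0].

Lemma integral_semigroup_measure t x (g : nat -> R) : (forall z, 0 <= g z <= 1) ->
  (\int[semigroup_measure t x]_z (g z)%:E = (semigroup `|t| g x)%:E)%E.
Proof.
move=> g01; have g0 z : 0 <= g z by have /andP[] := g01 z.
have e0 z : [set: nat] z -> (0 <= (g z)%:E)%E by rewrite lee_fin.
rewrite ge0_integral_measure_series//.
pose u n := poisson_weight (rate_bound delta lambda * `|t|) n * iter n jump g x.
rewrite (eq_eseriesr (g := EFin \o u)); last first.
  by move=> n _; rewrite ge0_integral_mscale//= integral_jump_measure// -EFinM.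
have cu : series u @ \oo --> semigroup `|t| g x.
  apply: (@cvg_poisson_mean _ _ 1) => n.
  by apply: iter_jump_norm => // z; rewrite ger0_norm//; have /andP[] := g01 z.
rewrite -(cvg_lim _ cu)// -EFin_lim; last by apply/cvg_ex; eexists; exact: cu.
by congr (limn _); apply/funext => n; rewrite /= /series/= -sumEFin.
Qed.

Lemma semigroup_measure_setT t x : semigroup_measure t x setT = 1%E.
Proof.
rewrite -[LHS]mul1e -(integral_cst (semigroup_measure t x) measurableT 1).
rewrite (@integral_semigroup_measure t x (cst 1)) => [|z]; last first.
  by rewrite /= lexx ler01.
congr EFin; rewrite /bd_semigroup (_ : (fun n => _) = cst 1) ?poisson_mean_cst//.
apply/funext => n; elim: n x => //= n IH x.
by rewrite /bd_jump !IH; ring.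
Qed.

Definition transition (t : R) (x : nat) : probability nat R :=
  unit_mass_probability (semigroup_measure_setT t x).

Lemma Rintegral_transition t x (g : nat -> R) : (forall z, 0 <= g z <= 1) ->
  \int[transition t x]_z (g z) = semigroup `|t| g x.
Proof. by move=> g01; rewrite /Rintegral integral_semigroup_measure. Qed.

Lemma transitionE t x A :
  transition t x A = (semigroup `|t| (fun z => (z \in A)%:R) x)%:E.
Proof.
rewrite -fineK_prob -Rintegral_set Rintegral_transition// => z.
by case: (_ \in _); rewrite ?lexx ?ler01.
Qed.

End kernels.

(** * The stationary process of a balanced law *)

Section stationary_process.
Variables (R : realType) (delta lambda : R) (mu : probability nat R).
Hypotheses (d0 : 0 <= delta) (l0 : 0 <= lambda).
Hypothesis bal : detailed_balance delta lambda (fun n => fine (mu [set n])).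

Local Notation jump := (bd_jump delta lambda mu).
Local Notation semigroup := (bd_semigroup delta lambda mu).

(** Invariance under one step.  By detailed balance, the sum of (J g - g) mu up to
n telescopes to the boundary flux (1 + delta) mu(n) (g(n+1) - g(n)) / C, which
tends to 0. *)
Lemma Rintegral_jump (g : nat -> R) (M : R) : (forall z, `|g z| <= M) ->
  \int[mu]_z jump g z = \int[mu]_z g z.
Proof.
move=> gM; pose w n := fine (mu [set n]).
have c1 := Rintegral_series (mu := mu) (jump_norm mu d0 l0 gM).
have c2 := Rintegral_series (mu := mu) gM.
have cS : series w @ \oo --> (1 : R) by exact: cvg_prob_initial.
have cw : w @ \oo --> (0 : R).
  by apply: cvg_series_cvg_0; apply/cvg_ex; eexists; exact: cS.
have C0 := rate_bound_gt0 d0 l0.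
have flux n : rate_bound delta lambda *
    (series (fun n => jump g n * w n) n.+1 - series (fun n => g n * w n) n.+1) =
    (1 + delta) * w n * (g n.+1 - g n).
  have E k : rate_bound delta lambda * (jump g k * w k - g k * w k) =
      generator delta lambda mu g k * w k.
    by rewrite (generator_jump _ d0 l0); ring.
  elim: n => [|n IH].
    have s1 (f : R^nat) : series f 1%N = f 0%N by rewrite seriesSr series0 add0r.
    rewrite !s1 E /generator ltnn mul0r mul0r addr0.
    by ring.
  rewrite seriesSr [X in _ - X]seriesSr.
  rewrite opprD addrACA mulrDr IH E /generator ltn0Sn mul1r /=.
  have := bal n; rewrite -/(w n) -/(w n.+1) series_prob => B.
  by rewrite B; ring.
have c3 : (fun n => rate_bound delta lambda *
    (series (fun n => jump g n * w n) n.+1 - series (fun n => g n * w n) n.+1)) @ \oo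
    --> rate_bound delta lambda * (\int[mu]_z jump g z - \int[mu]_z g z).
  apply: cvgM; first exact: cvg_cst.
  by apply: cvgB; rewrite (cvg_shiftS (series _)).
have c4 : (fun n => rate_bound delta lambda *
    (series (fun n => jump g n * w n) n.+1 - series (fun n => g n * w n) n.+1)) @ \oo
    --> (0 : R).
  rewrite (_ : (fun n => _) = (fun n => (1 + delta) * w n * (g n.+1 - g n)));
    last exact/funext.
  apply/norm_cvg0P.
  apply: (@squeeze_cvgr _ _ _ _ (cst 0) (fun n => (1 + delta) * w n * (2 * M))).
  - apply: nearW => n; rewrite normr_ge0/= normrM.
    rewrite ger0_norm ?mulr_ge0 ?addr_ge0 ?prob_ge0//.
    rewrite ler_wpM2l ?mulr_ge0 ?addr_ge0 ?prob_ge0//.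
    rewrite (le_trans (ler_normB _ _))//; have := gM n; have := gM n.+1; lra.
  - exact: cvg_cst.
  - rewrite -[X in _ --> X](mul0r (2 * M)); apply: cvgM; last exact: cvg_cst.
    by rewrite -[X in _ --> X](mulr0 (1 + delta)); apply: cvgM => //; exact: cvg_cst.
have /eqP : rate_bound delta lambda * (\int[mu]_z jump g z - \int[mu]_z g z) = 0.
  exact: (@cvg_unique _ (@Rhausdorff R) _ _ _ _ c3 c4).
by rewrite mulf_eq0 gt_eqF//= subr_eq0 => /eqP.
Qed.

(** Each power of the one-step operator preserves the integral; the Poisson
partial sums converge boundedly, so dominated convergence gives the mixture. *)
Lemma Rintegral_semigroup (t : R) (g : nat -> R) : 0 <= t ->
  (forall z, 0 <= g z <= 1) ->
  \int[mu]_z semigroup t g z = \int[mu]_z g z.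
Proof.
move=> t0 g01.
have gM z : `|g z| <= 1 by have /andP[? ?] := g01 z; rewrite ger0_norm.
have iM n z : `|iter n jump g z| <= 1 by exact: iter_jump_norm.
have In n : \int[mu]_z iter n jump g z = \int[mu]_z g z.
  by elim: n => // n IH; rewrite /= (Rintegral_jump (iM n)).
pose c := rate_bound delta lambda * t.
have c0 : 0 <= c by rewrite mulr_ge0// rate_bound_ge0.
pose a := poisson_weight c.
have a0 n : 0 <= a n by exact: poisson_weight_ge0.
have ca : series a @ \oo --> (1 : R).
  have := @cvg_poisson_mean _ (cst 1) 1 c; rewrite poisson_mean_cst.
  rewrite (_ : (fun n => poisson_weight c n * cst 1 n) = a).
    by apply=> n; rewrite normr1.
  by apply/funext => n; rewrite mulr1.
have na : nondecreasing_seq (series a).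
  by apply/nondecreasing_seqP => n; rewrite seriesSr lerDl.
have a1 n : series a n <= 1.
  rewrite -(cvg_lim _ ca)//; apply: nondecreasing_cvgn_le => //.
  by apply/cvg_ex; eexists; exact: ca.
pose f N z := series (fun n => a n * iter n jump g z) N.
have cf z : f ^~ z @ \oo --> semigroup t g z.
  by apply: (@cvg_poisson_mean _ _ 1) => n.
have fM N z : `|f N z| <= 1.
  apply: le_trans (a1 N); rewrite /f /series/=.
  apply: (le_trans (ler_norm_sum _ _ _)); apply: ler_sum => i _.
  by rewrite normrM (ger0_norm (a0 i)) ler_piMr.
have := cvg_Rintegral_seq (P := mu) fM cf.
rewrite (_ : (fun N => _) = (fun N => series a N * \int[mu]_z g z)); last first.
  apply/funext; elim=> [|N IH].
    rewrite series0 mul0r (_ : f 0%N = cst 0).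
      by rewrite Rintegral_cst// mul0r.
    by apply/funext => z; rewrite /f series0.
  rewrite seriesSr mulrDl -IH -(In N) -RintegralZl//; last first.
    exact: bounded_integrable (iM N).
  rewrite -RintegralD//.
  - by congr fine; apply: eq_integral => z _; rewrite /f seriesSr.
  - exact: bounded_integrable (fM N).
  - apply: (@bounded_integrable _ _ _ (a N)) => z.
    by rewrite normrM (ger0_norm (a0 N)) ler_piMr.
move=> cI; rewrite -[RHS]mul1r; apply: (@cvg_unique _ (@Rhausdorff R) _ _ _ _ cI).
by apply: cvgM => //; exact: cvg_cst.
Qed.

Let P (s t : R) := transition mu d0 l0 (t - s).

Let indic01 (A : set nat) z : (0 : R) <= (z \in A)%:R <= (1 : R).
Proof. by case: (_ \in _); rewrite ?lexx ?ler01. Qed.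

Let indicE (y : nat) :
  (fun z => (z \in [set y])%:R) = (fun z => (z == y)%:R) :> (nat -> R).
Proof.
apply/funext => z; rewrite (_ : (z \in [set y]) = (z == y))//.
by apply/idP/idP; rewrite inE => /eqP.
Qed.

Lemma stationary_process : nonlinear_process delta lambda (fun=> mu) P.
Proof.
split.
- move=> s x A s0; rewrite /P subrr transitionE normr0 semigroup0.
  by rewrite diracE.
- move=> s t u x A s0 st tu.
  have -> : (\int[P s t x]_z P t u z A =
     \int[P s t x]_z (semigroup (u - t) (fun z => (z \in A)%:R) z)%:E)%E.
    by apply: eq_integral => z _; rewrite /P transitionE ger0_norm// subr_ge0.
  have tu0 : 0 <= u - t by rewrite subr_ge0.
  have st0 : 0 <= t - s by rewrite subr_ge0.
  rewrite (integral_semigroup_measure mu d0 l0); last exact: semigroup01.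
  rewrite ger0_norm// semigroupD// transitionE ger0_norm; last first.
    by rewrite subr_ge0 (le_trans st).
  by congr (semigroup _ _ _)%:E; ring.
- move=> s t A s0 st.
  have -> : (\int[mu]_x P s t x A =
     \int[mu]_x (semigroup (t - s) (fun z => (z \in A)%:R) x)%:E)%E.
    by apply: eq_integral => z _; rewrite /P transitionE ger0_norm// subr_ge0.
  have st0 : 0 <= t - s by rewrite subr_ge0.
  rewrite -fineK_prob -Rintegral_set -(Rintegral_semigroup st0)//.
  rewrite fineK//; apply: integrable_fin_num => //.
  apply: (@bounded_integrable _ _ _ 1) => z.
  by have /andP[? ?] := semigroup01 mu d0 l0 st0 (indic01 A) z; rewrite ger0_norm.
- move=> s x y s0; apply: continuous_subspaceT => t.
  rewrite (_ : (fun t => _) =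
    (fun t => semigroup `|t - s| (fun z => (z == y)%:R) x)); last first.
    by apply/funext => u; rewrite transitionE /= indicE.
  apply: (@continuous_comp _ _ _ (fun t => `|t - s|) (fun u => semigroup u _ x)).
    by apply: cvg_norm; apply: cvgB; [exact: cvg_id|exact: cvg_cst].
  apply: (@semigroup_continuous _ _ _ _ d0 l0 _ 1) => z.
  by case: (_ == _); rewrite ?normr1 ?normr0.
- move=> t x y t0.
  have b1 z : `|(z == y)%:R| <= 1 :> R by case: (_ == _); rewrite ?normr1 ?normr0.
  have := is_derive_right (is_derive_semigroup mu d0 l0 0 x b1).
  rewrite (_ : jump (semigroup 0 _) x = jump (fun z => (z == y)%:R) x); last first.
    by rewrite /bd_jump !semigroup0.
  rewrite semigroup0 -(generator_jump _ d0 l0).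
  apply: cvg_trans; apply: near_eq_cvg; near=> h.
  have h0 : 0 < h by near: h; exact: nbhs_right_gt.
  by rewrite transitionE /= indicE (addrAC t) subrr !add0r ger0_norm ?ltW.
Unshelve. all: by end_near. Qed.

End stationary_process.

(** * The law of an arbitrary nonlinear process *)

Lemma generator_sum (R : realType) (delta lambda : R) (mu : probability nat R)
    (I : Type) (r : seq I) (f : I -> nat -> R) x :
  generator delta lambda mu (fun z => \sum_(i <- r) f i z) x =
  \sum_(i <- r) generator delta lambda mu (f i) x.
Proof.
rewrite /generator big_split/= -!mulr_sumr.
by rewrite !sumrB.
Qed.

Lemma generator_indicator_ge (R : realType) (delta lambda : R)
    (mu : probability nat R) x :
  0 <= delta -> 0 <= lambda ->
  - rate_bound delta lambda <=
  generator delta lambda mu (fun z => (z == x)%:R) x.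
Proof.
move=> d0 l0; rewrite /generator /rate_bound eqxx (gtn_eqF (ltnSn x)).
have F0 := prob_ge0 mu `I_x; have F1 := prob_le1 mu `I_x.
set F := fine _ in F0 F1 *.
have lF : lambda * F <= lambda by rewrite ler_piMr.
case: x @F F0 F1 lF => [|x] F F0 F1 lF; rewrite /= ?mul0r ?mul1r.
  by move: d0 l0; rewrite mulr0n mulr1n; lra.
by rewrite (ltn_eqF (ltnSn x)) mulr0n mulr1n; lra.
Qed.

(** Only the jumps between y and y.+1 change the indicator of [0, y]. *)
Lemma generator_initial (R : realType) (delta lambda : R)
    (mu : probability nat R) x y :
  generator delta lambda mu (fun z => (z \in `I_y.+1)%:R) x =
  (1 + lambda * fine (mu `I_y.+1)) * (x \in [set y.+1])%:R
  - (1 + delta) * (x \in [set y])%:R.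
Proof.
have E n z : (z \in `I_n) = (z < n)%N by apply/idP/idP; rewrite inE.
have E1 (n z : nat) : (z \in [set n]) = (z == n) by apply/idP/idP; rewrite inE => /eqP.
rewrite /generator !E !E1 !ltnS.
case: (ltngtP x y) => [xy|yx|->].
- have -> : (x.-1 <= y)%N by rewrite (leq_trans (leq_pred _))// ltnW.
  have -> : (x == y.+1) = false by rewrite ltn_eqF// ltnW.
  by rewrite !mulr1n !mulr0n; ring.
- case: x yx => // x; rewrite ltnS eqSS /= leq_eqVlt eq_sym => /orP[/eqP->|yx].
    by rewrite leqnn eqxx ?mulr1n ?mulr0n; ring.
  by rewrite leqNgt yx (gtn_eqF yx) ?mulr1n ?mulr0n; ring.
- rewrite (leq_pred y) (ltn_eqF (ltnSn y)).
  by rewrite !mulr1n !mulr0n; ring.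
Qed.

Section nonlinear_process_theory.
Variables (R : realType) (delta lambda : R).
Hypotheses (d0 : 0 <= delta) (l0 : 0 <= lambda).
Variables (m : R -> probability nat R) (p : R -> R -> nat -> probability nat R).
Hypothesis mp : nonlinear_process delta lambda m p.

Local Notation C := (rate_bound delta lambda).

(** By the Chapman-Kolmogorov relation g(t) = p s t x {x} satisfies
g(t + h) >= g(t) p t (t + h) x {x} >= g(t) (1 - (C + e) h) for small h, because the
rate at time t is at most C.  As g <= 1, the function g(t) + C (t - s) has
nonnegative lower right derivative.  The bound is uniform in x and s, which the
pointwise rates alone are not. *)
Lemma holding_probability (s t : R) x : 0 <= s -> s <= t ->
  1 - C * (t - s) <= fine (p s t x [set x]).
Proof.
move=> s0 st; pose f u := fine (p s u x [set x]) + C * (u - s).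
suff : f s <= f t.
  rewrite /f (np_diag mp)// diracE mem_set//= subrr mulr0 addr0; lra.
apply: right_Dini_ge0_le => //.
  have c1 := @np_continuous _ _ _ _ _ mp s x x s0.
  have ce : continuous (fun u => C * (u - s)).
    move=> u; apply: cvgM; first exact: cvg_cst.
    by apply: cvgB; [exact: cvg_id|exact: cvg_cst].
  have c2 : {within `[s, t], continuous (fun u => fine (p s u x [set x]))}.
    apply: continuous_subspaceW c1 => u /=.
    by rewrite !in_itv/= andbT => /andP[].
  by move=> u; apply: cvgD; [exact: c2|exact: (continuous_subspaceT ce)].
move=> u /andP[su ut] e e0; have u0 : 0 <= u := le_trans s0 su.
have /cvgrPdist_le /(_ _ e0) Hr := @np_rates _ _ _ _ _ mp u x x u0.
near=> h.
have h0 : 0 < h by near: h; exact: nbhs_right_gt.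
have := generator_indicator_ge (m u) x d0 l0.
set G := generator _ _ _ _ _ => G0.
have : `|G - (fine (p u (u + h) x [set x]) - (x == x)%:R) / h| <= e by near: h.
rewrite eqxx mulr1n ler_norml => /andP[_].
rewrite lerBlDr -lerBlDl ler_pdivlMr// => Gh.
have CK : fine (p u (u + h) x [set x]) * fine (p s u x [set x]) <=
    fine (p s (u + h) x [set x]).
  have -> : fine (p s (u + h) x [set x]) =
      \int[p s u x]_z (fine (p u (u + h) z [set x])).
    rewrite (@np_chapman_kolmogorov _ _ _ _ _ mp s u)// ?lerDl ?ltW//.
    by congr fine; apply: eq_integral => z _; rewrite fineK_prob.
  apply: (@Rintegral_ge_pt _ _ (fun z => fine (p u (u + h) z [set x])) 1).
  by move=> z; rewrite prob_ge0 prob_le1.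
have g0 := prob_ge0 (p s u x) [set x]; have g1 := prob_le1 (p s u x) [set x].
rewrite /f.
set g := fine (p s u x [set x]) in CK g0 g1 *.
set q := fine (p u _ x _) in CK Gh *.
have q1 : 1 - (C + e) * h <= q.
  have : (- C) * h <= G * h by rewrite ler_pM2r.
  by move: Gh; lra.
have := ler_wpM2r g0 q1.
have : 0 <= (1 - g) * ((C + e) * h).
  have C0 : 0 <= C + e by rewrite addr_ge0 ?rate_bound_ge0// ltW.
  by rewrite !mulr_ge0 ?subr_ge0// ltW.
lra.
Unshelve. all: by end_near. Qed.

(** Whether or not x lies in A, the numerator is at most the probability of having
left x. *)
Lemma transition_rate_le (s h : R) x (A : set nat) : 0 <= s -> 0 < h ->
  `|(fine (p s (s + h) x A) - (x \in A)%:R) / h| <= C.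
Proof.
move=> s0 h0; have hd := d0; have hl := l0.
have H := @holding_probability s (s + h) x s0.
have {H} := H _; rewrite lerDl ltW// => /(_ isT).
rewrite addrAC subrr add0r => H.
rewrite normrM normfV (gtr0_norm h0) ler_pdivrMr//.
have [/set_mem xA|/negP xA] := boolP (x \in A).
  have : fine (p s (s + h) x [set x]) <= fine (p s (s + h) x A).
    by apply: prob_le => _ ->.
  have := prob_le1 (p s (s + h) x) A.
  by rewrite ler_norml mulr1n => *; apply/andP; split; lra.
have : fine (p s (s + h) x A) + fine (p s (s + h) x [set x]) <= 1.
  rewrite -probU ?prob_le1//; apply/seteqP; split=> // z [zA /= zx].
  by apply: xA; rewrite inE -zx.
have := prob_ge0 (p s (s + h) x) A.
by rewrite ler_norml mulr0n subr0 => *; apply/andP; split; lra.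
Qed.

Lemma law_increment (s h : R) (A : set nat) : 0 <= s -> 0 < h ->
  (fine (m (s + h) A) - fine (m s A)) / h =
  \int[m s]_z ((fine (p s (s + h) z A) - (z \in A)%:R) / h).
Proof.
move=> s0 h0.
have i1 : (m s).-integrable setT (EFin \o (fun z => fine (p s (s + h) z A))).
  by apply: (@bounded_integrable _ _ _ 1) => z; rewrite ger0_norm ?prob_ge0 ?prob_le1.
have i2 := indicator_integrable (m s) A.
have -> : fine (m (s + h) A) = \int[m s]_z fine (p s (s + h) z A).
  rewrite (@np_law _ _ _ _ _ mp s)// ?lerDl ?ltW//.
  by congr fine; apply: eq_integral => z _; rewrite fineK_prob.
rewrite -(Rintegral_set (m s) A) -RintegralB// mulrC -RintegralZl//.
  by congr fine; apply: eq_integral => z _; rewrite mulrC.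
apply: (@bounded_integrable _ _ _ (C * h)) => z.
by rewrite -ler_pdivrMr// -[X in _ / X](gtr0_norm h0) -normfV -normrM transition_rate_le.
Qed.

Lemma law_lipschitz (s t : R) (A : set nat) : 0 <= s -> 0 <= t ->
  `|fine (m s A) - fine (m t A)| <= C * `|s - t|.
Proof.
wlog st : s t / s < t => [H|] s0 t0.
  have [st|ts|->] := ltgtP s t; first exact: H.
    by rewrite distrC (distrC s t); exact: H.
  by rewrite !subrr !normr0 mulr0.
have h0 : 0 < t - s by rewrite subr_gt0.
rewrite distrC (distrC s t) (gtr0_norm h0) -ler_pdivrMr//.
rewrite -[X in _ / X](gtr0_norm h0) -normfV -normrM.
have := law_increment A s0 h0; rewrite (addrC s) subrK => ->.
apply: Rintegral_norm_le => z.
by have := transition_rate_le z A s0 h0; rewrite (addrC s) subrK.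
Qed.

Lemma law_continuous (T : R) (A : set nat) :
  {within `[0, T], continuous (fun t => fine (m t A))}.
Proof.
have C0 : 0 < C by exact: rate_bound_gt0.
apply/subspace_continuousP => t; rewrite /= in_itv/= => /andP[t0 _].
apply/cvgrPdist_le => e e0; rewrite near_withinE.
near=> u; rewrite /= in_itv/= => /andP[u0 _].
apply: (le_trans (law_lipschitz A t0 u0)).
rewrite mulrC -ler_pdivlMr//.
by near: u; apply: (@cvgr_dist_le _ _ _ (nbhs t) _ id t (@cvg_id _ _)); exact: divr_gt0.
Unshelve. all: by end_near. Qed.

(** The mass of [0, y] changes only through the flux between y and y.+1.  The
convergence of the rates is pointwise in the starting point; the uniform bound
[transition_rate_le] permits dominated convergence under the current law. *)
Lemma forward_equation (t : R) y : 0 <= t ->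
  (fine (m (t + h) `I_y.+1) - fine (m t `I_y.+1)) / h @[h --> 0^'+] -->
  (1 + lambda * fine (m t `I_y.+1)) * fine (m t [set y.+1])
  - (1 + delta) * fine (m t [set y]).
Proof.
move=> t0.
have ib (c : R) (A : set nat) :
    (m t).-integrable setT (EFin \o (fun z : nat => c * (z \in A)%:R)).
  apply: (@bounded_integrable _ _ _ `|c|) => z; rewrite normrM.
  by case: (_ \in _); rewrite ?normr1 ?normr0 ?mulr1// mulr0.
have i1 := indicator_integrable (m t).
have -> : (1 + lambda * fine (m t `I_y.+1)) * fine (m t [set y.+1])
  - (1 + delta) * fine (m t [set y]) =
  \int[m t]_z generator delta lambda (m t) (fun z => (z \in `I_y.+1)%:R) z.
  rewrite -(Rintegral_set _ [set y]) -(Rintegral_set _ [set y.+1]) -!RintegralZl//.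
  rewrite -RintegralB//.
  by congr fine; apply: eq_integral => z _; rewrite generator_initial.
set phi := generator _ _ _ _.
have phiP x : (fine (p t (t + h) x `I_y.+1) - (x \in `I_y.+1)%:R) / h
    @[h --> 0^'+] --> phi x.
  have E z : (z \in `I_y.+1)%:R = \sum_(i < y.+1) (z == i)%:R :> R.
    have [/set_mem/= zy|/negP zy] := boolP (z \in _).
      rewrite (bigD1 (Ordinal zy))//= eqxx big1 ?addr0// => i /eqP iz.
      by case: eqP => // zi; case: iz; apply: val_inj.
    rewrite big1// => i _; case: eqP => // zi; case: zy.
    by rewrite inE/= zi.
  rewrite /phi (_ : (fun z : nat => _) =
    (fun z => \sum_(i < y.+1) (z == i)%:R)); last exact/funext.
  rewrite generator_sum (_ : (fun h : R => _) = (fun h => \sum_(i < y.+1)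
    (fine (p t (t + h) x [set (i : nat)]) - (x == i)%:R) / h)); last first.
    by apply/funext => h; rewrite prob_initial E -sumrB mulr_suml.
  apply: cvg_big => [|i _]; first exact: add_continuous.
  exact: (np_rates mp).
have phiC (h : R) x : 0 < h ->
    `|(fine (p t (t + h) x `I_y.+1) - (x \in `I_y.+1)%:R) / h| <= C.
  exact: transition_rate_le.
apply: cvg_trans (cvg_Rintegral (P := m t) phiC phiP).
apply: near_eq_cvg; near=> h.
have h0 : 0 < h by near: h; exact: nbhs_right_gt.
by rewrite law_increment.
Unshelve. all: by end_near. Qed.

End nonlinear_process_theory.

(** * Constant laws and detailed balance *)

Section balance_and_laws.
Variables (R : realType) (delta lambda : R).
Hypotheses (d0 : 0 <= delta) (l0 : 0 <= lambda).
Variables (m : R -> probability nat R) (p : R -> R -> nat -> probability nat R).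
Hypothesis mp : nonlinear_process delta lambda m p.

Lemma constant_law_balance : (forall t, 0 <= t -> m t =1 m 0) ->
  detailed_balance delta lambda (fun n => fine (m 0 [set n])).
Proof.
move=> mc n; rewrite series_prob.
have := forward_equation d0 l0 mp (y := n) (lexx 0).
set L := (X in _ --> X) => cL.
suff : L = 0 by rewrite /L => /eqP; rewrite subr_eq0 => /eqP.
apply: (@cvg_unique _ (@Rhausdorff R) _ _ _ _ cL).
have c0 : cst (0 : R) h @[h --> (0 : R)^'+] --> (0 : R) by exact: cvg_cst.
apply: cvg_trans c0.
apply: near_eq_cvg; near=> h.
have h0 : 0 <= h by apply: ltW; near: h; exact: nbhs_right_gt.
by rewrite add0r mc// subrr mul0r.
Unshelve. all: by end_near. Qed.

(** In the unknowns F_t(y) the nonlinear forward equation is closed and local, and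
its right-hand side is Lipschitz for the supremum norm on bounded F.  Comparing
with the constant solution F_0 through [gronwall_family] gives uniqueness. *)
Lemma balanced_law_constant :
  detailed_balance delta lambda (fun n => fine (m 0 [set n])) ->
  forall t, 0 <= t -> m t =1 m 0.
Proof.
move=> bal t t0; apply: prob_nat_ext => n; apply/eqP; rewrite -subr_eq0; apply/eqP.
pose F t n := fine (m t `I_n).
pose D n t := F t n - F 0 n.
(* the mass of the empty set [0, 0) has derivative 0 *)
pose flux t n := if n is y.+1 then
   (1 + lambda * F t y.+1) * (F t y.+2 - F t y.+1) - (1 + delta) * (F t y.+1 - F t y)
  else 0.
have Fs u y : fine (m u [set y]) = F u y.+1 - F u y.
  by rewrite /F prob_initialS addrAC subrr add0r.
have F01 u y : 0 <= F u y <= 1 by rewrite prob_ge0 prob_le1.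
have B y : (1 + delta) * (F 0 y.+1 - F 0 y) =
    (1 + lambda * F 0 y.+1) * (F 0 y.+2 - F 0 y.+1).
  by have := bal y; rewrite series_prob !Fs.
have k0 : 0 < 2 * (1 + delta) + 2 * (1 + lambda) + lambda.
  by have hd := d0; have hl := l0; lra.
apply: (@gronwall_family R nat D (fun n t => flux t n) _ k0) => //.
- move=> i T _ x; apply: cvgB; last exact: cvg_cst.
  exact: (law_continuous d0 l0 mp).
- by move=> i; rewrite /D subrr.
- move=> i u u0; rewrite ler_norml /D.
  by have /andP[] := F01 u i; have /andP[] := F01 0 i; move=> *; apply/andP; split; lra.
- move=> [|y] u u0.
    rewrite (_ : (fun h => _) = cst 0); first exact: cvg_cst.
    by apply/funext => h; rewrite /D /F II0 !measure0/= !subrr mul0r.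
  rewrite /flux -!Fs.
  have := forward_equation d0 l0 mp (y := y) u0; apply: cvg_trans.
  apply: near_eq_cvg; apply: nearW => h.
  by rewrite /D opprB addrA subrK.
move=> i u s u0 Ds.
have s0 : 0 <= s by apply: le_trans (Ds 0%N).
case: i => [|y].
  by rewrite normr0 mulr_ge0// ltW.
rewrite /flux.
have E k : F u k = D k u + F 0 k by rewrite /D subrK.
(* Subtract the balance equation of F 0; the last term is the variation of the
   death rate, weighted by a mass of the initial law. *)
have -> : (1 + lambda * F u y.+1) * (F u y.+2 - F u y.+1) -
    (1 + delta) * (F u y.+1 - F u y) =
    (1 + lambda * F u y.+1) * (D y.+2 u - D y.+1 u) -
    (1 + delta) * (D y.+1 u - D y u) +
    lambda * D y.+1 u * (F 0 y.+2 - F 0 y.+1).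
  rewrite (E y.+2) (E y.+1) (E y); have := B y.
  move: (F 0 y.+2) (F 0 y.+1) (F 0 y) (D y.+2 u) (D y.+1 u) (D y u).
  move=> a b c e f g H.
  apply/eqP; rewrite -subr_eq0.
  rewrite (_ : _ - _ = (1 + lambda * b) * (a - b) - (1 + delta) * (b - c)).
    by rewrite H subrr.
  by ring.
have /andP[Fu0 Fu1] := F01 u y.+1.
have /andP[Fa0 Fa1] := F01 0 y.+1.
have Fb1 : F 0 y.+2 <= 1 by have /andP[] := F01 0 y.+2.
have Fab : 0 <= F 0 y.+2 - F 0 y.+1 by rewrite -Fs prob_ge0.
have n2 a b : `|a| <= s -> `|b| <= s -> `|a - b| <= 2 * s.
  move=> ha hb; rewrite (le_trans (ler_normB _ _))//; lra.
have lF : 0 <= lambda * F u y.+1 <= lambda by rewrite mulr_ge0//= ler_piMr.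
have -> : (2 * (1 + delta) + 2 * (1 + lambda) + lambda) * s =
    (1 + lambda) * (2 * s) + (1 + delta) * (2 * s) + lambda * s * 1 by ring.
rewrite (le_trans (ler_normD _ _))//; apply: lerD.
  rewrite (le_trans (ler_normB _ _))//; apply: lerD; rewrite normrM ler_pM//.
  - by case/andP: lF => *; rewrite ger0_norm ?lerD2l// addr_ge0.
  - exact: n2.
  - by rewrite ger0_norm// addr_ge0.
  - exact: n2.
rewrite normrM normrM (ger0_norm l0) (ger0_norm Fab) ler_pM//.
- by rewrite mulr_ge0.
- by rewrite ler_wpM2l.
- lra.
Qed.

End balance_and_laws.

Theorem theorem3 (R : realType) (delta lambda : R)
    (hdelta : 0 <= delta) (hlambda : 0 <= lambda) :
  (4 * delta < lambda ->
     exists mu : probability nat R, stationary_distribution delta lambda mu) /\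
  (lambda <= 2 * delta ->
     ~ exists mu : probability nat R, stationary_distribution delta lambda mu).
Proof.
split=> [ld|ld [mu [[m [p [mp m0]]] cst_law]]].
  have ld3 : 3 * delta < lambda by apply: le_lt_trans ld; rewrite ler_wpM2r// ler_nat.
  have [w [w0 bal w1]] := detailed_balance_ex hdelta hlambda ld3.
  have [mu muw] := probability_of_weights w0 w1.
  have balmu : detailed_balance delta lambda (fun n => fine (mu [set n])).
    by rewrite (_ : (fun n => _) = w)//; exact/funext.
  exists mu; split.
    by do 2 eexists; split; first exact: (stationary_process hdelta hlambda balmu).
  move=> m p mp m0 t t0 A; rewrite -m0.
  apply: (balanced_law_constant hdelta hlambda mp) => //.
  rewrite (_ : (fun n => _) = (fun n => fine (mu [set n])))//.
  by apply/funext => n; rewrite m0.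
have bal : detailed_balance delta lambda (fun n => fine (m 0 [set n])).
  apply: (constant_law_balance hdelta hlambda mp) => t t0 A.
  by rewrite (cst_law _ _ mp m0 t t0) m0.
apply: (no_detailed_balance hdelta hlambda ld _ bal); last exact: cvg_prob_initial.
by move=> n; exact: prob_ge0.
Qed.
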